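(* Every number field $K\subset\mathbb{R}$ is the periodic direction field of a completely algebraically periodic translation surface that arises from a right-angled billiard table.
   Context: A translation surface is a compact (connected, oriented) surface $S$ obtained by gluing finitely many polygons in $\mathbb{R}^2$ along parallel edges by translations; $\Sigma$ denotes its set of singular points. View $\mathbb{R}^2$ and $\mathbb{R}$ as $\mathbb{Q}$-vector spaces. Take an edge-to-edge decomposition of $S$ into Euclidean triangles $\Delta_j$ whose vertex set contains $\Sigma$, and let $v_j,w_j\in\mathbb{R}^2$ be two successive sides of $\Delta_j$ in counterclockwise order. The $J$-invariant is $J(S)=\sum_j v_j\wedge w_j\in\mathbb{R}^2\wedge_{\mathbb{Q}}\mathbb{R}^2$ (independent of the triangulation). For $0\ne v\in\mathbb{R}^2$ let $\pi:\mathbb{R}^2\to\mathbb{R}$ be the orthogonal projection with kernel $\mathbb{R}v$, and let $\mathrm{SAF}_v(S)\in\mathbb{R}\wedge_{\mathbb{Q}}\mathbb{R}$ be the image of $J(S)$ under the map induced by $\pi$. The direction $v$ is algebraically periodic if $\mathrm{SAF}_v(S)=0$. If $S$ has at least three algebraically periodic directions, then after a linear change of coordinates so that the directions of slopes $0,1,\infty$ are algebraically periodic, the set of finite slopes of algebraically periodic directions is a subfield of $\mathbb{R}$ (independent of the choices), called the periodic direction field of $S$. The holonomy of $S$ is the image of $\mathrm{hol}:H_1(S,\Sigma;\mathbb{Q})\to\mathbb{R}^2$, $\sigma\mapsto(\int_\sigma dx,\int_\sigma dy)$. A homological direction is the direction of a non-zero vector in the holonomy. $S$ is completely algebraically periodic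 if every homological direction is algebraically periodic. A right-angled billiard table is a compact connected polygonal region in the plane all of whose angles are integer multiples of $\pi/2$ (so, after a rotation, all sides are horizontal or vertical). The translation surface arising from it is its unfolding: take the four images of the table under the group generated by the reflections in the coordinate axes, and glue each side of each copy by translation to the corresponding side of the copy obtained by reflecting in that side. *)

(* Defs.v *)
From HB Require Import structures.
From mathcomp Require Import all_boot all_order all_algebra.
From mathcomp Require Import fieldext.
From mathcomp Require Import finmap boolp classical_sets reals trigo.
From mathcomp Require Import monalg.
From mathcomp Require Import ring lra.

Set Implicit Arguments.
Unset Strict Implicit.
Unset Printing Implicit Defensive.

Import Order.TTheory GRing.Theory Num.Theory.

Local Open Scope quotient_scope.
Local Open Scope ring_scope.

Notation formal V := {malg rat[(V * V)%type]}.

Section Wedge.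
Variables (R : realType) (V : lmodType R).

Definition fpair (u v : V) : formal V := << (u, v) >>.

(* The combinations that vanish in the exterior square of V over Q, where a
   rational acts on V through its image in R. *)
Inductive wedge_null : formal V -> Prop :=
| Null_addl u u' v :
    wedge_null (fpair (u + u') v - fpair u v - fpair u' v)
| Null_addr u v v' :
    wedge_null (fpair u (v + v') - fpair u v - fpair u v')
| Null_scalel (c : rat) u v :
    wedge_null (fpair (ratr c *: u) v - c *: fpair u v)
| Null_scaler (c : rat) u v :
    wedge_null (fpair u (ratr c *: v) - c *: fpair u v)
| Null_alt u : wedge_null (fpair u u)
| Null_zero : wedge_null 0
| Null_add x y : wedge_null x -> wedge_null y -> wedge_null (x + y)
| Null_scale (c : rat) x : wedge_null x -> wedge_null (c *: x).

Definition wedge_nullb : {pred (formal V)} := fun x => `[< wedge_null x >].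

Lemma wedge_null_zmod_closed : zmod_closed wedge_nullb.
Proof.
split=> [|x y /asboolP nx /asboolP ny]; apply/asboolP; first exact: Null_zero.
by rewrite -scaleN1r; apply: Null_add => //; apply: Null_scale.
Qed.
HB.instance Definition _ :=
  GRing.isZmodClosed.Build (formal V) wedge_nullb wedge_null_zmod_closed.

Definition wedge_square : zmodType := Quotient.quot wedge_nullb.

Definition wedge (u v : V) : wedge_square := \pi_(Quotient.quot wedge_nullb) (fpair u v).

Lemma wedge_eqP (x y : formal V) :
  reflect (\pi_wedge_square x = \pi_wedge_square y) (x - y \in wedge_nullb).
Proof. by rewrite Quotient.idealrBE; apply/eqP. Qed.

Lemma wedgeDl u u' v : wedge (u + u') v = wedge u v + wedge u' v.
Proof.
rewrite /wedge -raddfD; apply/wedge_eqP/asboolP.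
by rewrite opprD addrA; exact: Null_addl.
Qed.

Lemma wedgeDr u v v' : wedge u (v + v') = wedge u v + wedge u v'.
Proof.
rewrite /wedge -raddfD; apply/wedge_eqP/asboolP.
by rewrite opprD addrA; exact: Null_addr.
Qed.

Lemma wedgevv u : wedge u u = 0.
Proof.
rewrite /wedge -(raddf0 \pi_wedge_square); apply/wedge_eqP/asboolP.
by rewrite subr0; exact: Null_alt.
Qed.

Lemma wedge_scale (c : rat) u v :
  wedge (ratr c *: u) v = wedge u (ratr c *: v).
Proof.
apply/wedge_eqP/asboolP.
rewrite -(subrKA (c *: fpair u v)) -[X in wedge_null (_ + X)]opprB.
apply: Null_add; first exact: Null_scalel.
by rewrite -scaleN1r; apply: Null_scale; exact: Null_scaler.
Qed.

End Wedge.

Arguments wedge_square {R} V.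

Section WedgeMap.
Variables (R : realType) (V W : lmodType R) (f : V -> W).

Definition formal_map (x : formal V) : formal W :=
  \sum_(k <- msupp x) x@_k *: fpair (f k.1) (f k.2).

(* Computed on a representative; by wedge_mapE the choice is irrelevant when f
   is linear. *)
Definition wedge_map (x : wedge_square V) : wedge_square W :=
  \pi_(wedge_square W) (formal_map (repr x)).

Lemma formal_mapEw (d : {fset (V * V)%type}) (x : formal V) :
  (msupp x `<=` d)%fset ->
  formal_map x = \sum_(k <- d) x@_k *: fpair (f k.1) (f k.2).
Proof.
move=> sxd; rewrite /formal_map (big_fset_incl _ sxd) // => k _ kx.
by rewrite mcoeff_outdom // scale0r.
Qed.

Lemma formal_mapD x y : formal_map (x + y) = formal_map x + formal_map y.
Proof.
pose d := (msupp x `|` msupp y)%fset.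
rewrite !(@formal_mapEw d) ?fsubsetUl ?fsubsetUr ?msuppD_le // -big_split /=.
by apply: eq_bigr => k _; rewrite -scalerDl mcoeffD.
Qed.

Lemma formal_mapZ (c : rat) x : formal_map (c *: x) = c *: formal_map x.
Proof.
rewrite (@formal_mapEw (msupp x)) ?msuppZ_le // scaler_sumr.
by apply: eq_bigr => k _; rewrite mcoeffZ scalerA.
Qed.

Lemma formal_map_pair u v : formal_map (fpair u v) = fpair (f u) (f v).
Proof.
have sE : msupp (fpair u v) = [fset (u, v)]%fset by rewrite /fpair msuppU oner_eq0.
by rewrite /formal_map sE big_seq_fset1 /fpair mcoeffUU scale1r.
Qed.

Lemma formal_mapB x y : formal_map (x - y) = formal_map x - formal_map y.
Proof. by rewrite -scaleN1r formal_mapD formal_mapZ scaleN1r. Qed.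

Lemma formal_map_null x :
  linear f -> wedge_null x -> wedge_null (formal_map x).
Proof.
move=> fl; have fZ a u : f (a *: u) = a *: f u.
  have f0 : f 0 = 0 by have := fl 1 0 0; rewrite scaler0 add0r scale1r => /eqP;
    rewrite -subr_eq0 opprD addNKr oppr_eq0 => /eqP.
  by have := fl a u 0; rewrite !addr0 f0 addr0.
have fD u v : f (u + v) = f u + f v by have := fl 1 u v; rewrite !scale1r.
elim=> [u u' v|u v v'|c u v|c u v|u||y z _ IHy _ IHz|c y _ IHy];
  rewrite ?formal_mapB ?formal_mapD ?formal_mapZ ?formal_map_pair ?fD ?fZ.
- exact: Null_addl.
- exact: Null_addr.
- exact: Null_scalel.
- exact: Null_scaler.
- exact: Null_alt.
- rewrite -(scale0r (0 : formal V)) formal_mapZ scale0r; exact: Null_zero.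
- exact: Null_add.
- exact: Null_scale.
Qed.

Lemma wedge_mapE x : linear f ->
  wedge_map (\pi_(wedge_square V) x) = \pi_(wedge_square W) (formal_map x).
Proof.
move=> fl; apply/wedge_eqP; rewrite -formal_mapB.
apply/asboolP/formal_map_null => //; apply/asboolP/wedge_eqP.
by rewrite reprK.
Qed.

Lemma wedge_map_wedge u v : linear f ->
  wedge_map (wedge u v) = wedge (f u) (f v).
Proof. by move=> fl; rewrite wedge_mapE // formal_map_pair. Qed.

Lemma wedge_mapD x y : linear f ->
  wedge_map (x + y) = wedge_map x + wedge_map y.
Proof.
move=> fl; rewrite -[x]reprK -[y]reprK -raddfD !wedge_mapE //.
by rewrite formal_mapD raddfD.
Qed.

End WedgeMap.

Section Plane.
Variable R : realType.
Implicit Types u v w : 'rV[R]_2.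

Definition vec2 (x y : R) : 'rV[R]_2 := \row_j if j == 0 then x else y.

Definition det2 u v : R := u 0 0 * v 0 1 - u 0 1 * v 0 0.

Definition dot u v : R := u 0 0 * v 0 0 + u 0 1 * v 0 1.

Definition norm2 v : R := Num.sqrt (dot v v).

Definition angle u v : R := acos (dot u v / (norm2 u * norm2 v)).

(* The orthogonal projection with kernel R v, the line orthogonal to v being
   identified with R through its unit vector (- v_y, v_x) / |v|. *)
Definition proj v (u : 'rV[R]_2) : R^o := det2 v u / norm2 v.

Lemma proj_linear v : linear (proj v).
Proof. by move=> a u w; rewrite /proj /det2 !mxE /GRing.scale /=; ring. Qed.

Lemma vec2P v w : v 0 0 = w 0 0 -> v 0 1 = w 0 1 -> v = w.
Proof.
move=> h0 h1; apply/rowP; case=> [[|[|//]] hi].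
  by rewrite (_ : Ordinal hi = 0) //; apply/val_inj.
by rewrite (_ : Ordinal hi = 1) //; apply/val_inj.
Qed.

Lemma det2_mul u v (g : 'M[R]_2) : det2 (u *m g) (v *m g) = det2 u v * \det g.
Proof.
rewrite /det2 !mxE (expand_det_row _ 0) !big_ord_recl !big_ord0 /cofactor.
rewrite !det_mx11 !mxE /= !addr0.
rewrite (_ : lift 0 0 = 1 :> 'I_2); last exact/val_inj.
rewrite (_ : lift 1 0 = 0 :> 'I_2); last exact/val_inj.
by rewrite /= expr0 expr1; ring.
Qed.

End Plane.

(* Indices of the sides of a triangle live in Z/3; under an
   orientation-reversing map the cyclic order is reversed. *)
Definition flip (b : bool) (k : 'I_3) : 'I_3 := if b then - k else k.

Lemma flipK b : involutive (flip b).
Proof. by case: b => k //=; rewrite opprK. Qed.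

Lemma sum_flip (V : zmodType) b (F : 'I_3 -> V) :
  \sum_k F (flip b k) = \sum_k F k.
Proof. by rewrite [RHS](reindex_inj (can_inj (flipK b))). Qed.

Lemma ord3P (P : 'I_3 -> Prop) (k : 'I_3) :
  P k -> P (k + 1) -> P (k + 1 + 1) -> forall j, P j.
Proof.
move=> h0 h1 h2 j.
have: [|| j == k, j == k + 1 | j == k + 1 + 1].
  by case: k j {h0 h1 h2} => [[|[|[|//]]] ?] [[|[|[|//]]] ?].
by case/or3P=> /eqP->.
Qed.

Section Tri.
Variable R : realType.
Implicit Type s : 'I_3 -> 'rV[R]_2.

Lemma det2_side s k : \sum_k s k = 0 ->
  det2 (s k) (s (k + 1)) = det2 (s 0) (s 1).
Proof.
rewrite !big_ord_recl big_ord0 addr0 => h.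
have {h}: s 0 + s 1 + s (1 + 1) = 0.
  by rewrite -[RHS]h addrA; congr (_ + s _ + s _); apply/val_inj.
move=> h; have h0 : s 0 0 0 + s 1 0 0 + s (1 + 1) 0 0 = 0.
  by move/rowP/(_ 0): h; rewrite !mxE.
have h1 : s 0 0 1 + s 1 0 1 + s (1 + 1) 0 1 = 0.
  by move/rowP/(_ 1): h; rewrite !mxE.
move: k; apply: (@ord3P _ 0); rewrite ?add0r //.
  rewrite /det2; move: h0 h1; set a := s 0; set b := s 1; set c := s _ => h0 h1.
  have -> : c 0 0 = - (a 0 0 + b 0 0) by lra.
  have -> : c 0 1 = - (a 0 1 + b 0 1) by lra.
  by ring.
rewrite (_ : 1 + 1 + 1 = 0 :> 'I_3); last exact/val_inj.
rewrite /det2; move: h0 h1; set a := s 0; set b := s 1; set c := s _ => h0 h1.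
have -> : c 0 0 = - (a 0 0 + b 0 0) by lra.
have -> : c 0 1 = - (a 0 1 + b 0 1) by lra.
by ring.
Qed.

End Tri.

(* A translation surface, given by an edge-to-edge decomposition into Euclidean
   triangles.  [side t 0], [side t 1], [side t (1 + 1)] are the successive sides
   of t in counterclockwise order, and [glue] pairs each side with the opposite
   side to which it is glued by a translation.  All singular points
   are vertices of the decomposition, since the metric is flat elsewhere. *)
Record translation_surface (R : realType) := TranslationSurface {
  face : finType;
  side : face -> 'I_3 -> 'rV[R]_2;
  glue : face * 'I_3 -> face * 'I_3;
  face_nonempty : (0 < #|face|)%N;
  side_sum : forall t, \sum_k side t k = 0;
  side_ccw : forall t, 0 < det2 (side t 0) (side t 1);
  glueK : involutive glue;
  side_glue : forall e, side (glue e).1 (glue e).2 = - side e.1 e.2;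
  face_connected : forall s t,
    connect [rel x y | [exists k, (glue (x, k)).1 == y]] s t
}.

Section Surface.
Variables (R : realType) (S : translation_surface R).
Implicit Types (e q : face S * 'I_3) (v : 'rV[R]_2).

Definition Jinv : wedge_square 'rV[R]_2 :=
  \sum_(t : face S) wedge (side t 0) (side t 1).

Definition SAF v : wedge_square R^o := wedge_map (proj v) Jinv.

Definition alg_periodic v : Prop := v != 0 /\ SAF v = 0.

(* The pair (t, k) also denotes the corner of t from which its k-th side starts.
   [rot] maps a corner to the next one counterclockwise around the same vertex,
   so that the vertices of the triangulation are the orbits of [rot]. *)
Definition rot e : face S * 'I_3 := glue (e.1, e.2 - 1).

Definition corner_angle e : R := angle (side e.1 e.2) (- side e.1 (e.2 - 1)).

Definition cone_angle q : R := \sum_(e | fconnect rot q e) corner_angle e.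

Definition singular q : bool := cone_angle q != 2 * pi.

(* Rational simplicial 1-cycles relative to the singular points.  The chain c
   gives weight [c e] to the oriented side e; [e] and [glue e] are the same edge
   with its two orientations.  The k-th side of t ends at the corner (t, k + 1). *)
Definition relative_cycle (c : face S * 'I_3 -> rat) : Prop :=
  forall q, ~~ singular q ->
    \sum_(e | fconnect rot q (e.1, e.2 + 1)) c e = \sum_(e | fconnect rot q e) c e.

Definition holonomy : set 'rV[R]_2 :=
  [set v | exists2 c, relative_cycle c &
             v = \sum_e ratr (c e) *: side e.1 e.2].

Definition completely_algebraically_periodic : Prop :=
  forall v, holonomy v -> v != 0 -> alg_periodic v.

End Surface.

Section Transform.
Variables (R : realType) (S : translation_surface R).
Variables (g : 'M[R]_2) (gU : g \in unitmx).

(* When det g < 0, the counterclockwise boundary of the image of a triangle is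
   the image of its clockwise boundary. *)
Let b := \det g < 0.

Definition transform_side (t : face S) k := (-1) ^+ b *: (side t (flip b k) *m g).

Definition transform_glue (e : face S * 'I_3) : face S * 'I_3 :=
  let f := glue (e.1, flip b e.2) in (f.1, flip b f.2).

Lemma transform_sum t : \sum_k transform_side t k = 0.
Proof.
by rewrite -scaler_sumr (sum_flip b (fun k => side t k *m g)) -mulmx_suml
  side_sum mul0mx scaler0.
Qed.

Lemma det2Z (c : R) u v : det2 (c *: u) (c *: v) = c ^+ 2 * det2 u v.
Proof. by rewrite /det2 !mxE; ring. Qed.

Lemma det2C (u v : 'rV[R]_2) : det2 u v = - det2 v u.
Proof. by rewrite /det2; ring. Qed.

Lemma transform_ccw t : 0 < det2 (transform_side t 0) (transform_side t 1).
Proof.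
rewrite /transform_side det2Z sqrr_sign mul1r det2_mul /flip /b.
have g0 : \det g != 0 by rewrite -unitfE -unitmxE.
have [gn|gp] := ltP (\det g) 0; last first.
  by rewrite mulr_gt0 ?side_ccw // lt_def g0.
rewrite oppr0 det2C mulNr oppr_gt0 pmulr_rlt0 //.
by have := det2_side (- 1) (side_sum t); rewrite addNr => ->; apply: side_ccw.
Qed.

Lemma transform_glueK : involutive transform_glue.
Proof.
by case=> t k; rewrite /transform_glue /= flipK -surjective_pairing glueK /= flipK.
Qed.

Lemma transform_side_glue e :
  transform_side (transform_glue e).1 (transform_glue e).2
  = - transform_side e.1 e.2.
Proof.
rewrite /transform_side /transform_glue /= flipK side_glue /=.
by rewrite mulNmx scalerN.
Qed.

Lemma transform_connected (s t : face S) :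
  connect [rel x y | [exists k, (transform_glue (x, k)).1 == y]] s t.
Proof.
apply: connect_sub (face_connected s t) => x y /existsP[k /eqP kP].
by apply/connect1/existsP; exists (flip b k); rewrite /transform_glue /= flipK kP.
Qed.

Definition transform : translation_surface R :=
  TranslationSurface (face_nonempty S) transform_sum transform_ccw
    transform_glueK transform_side_glue transform_connected.

End Transform.

Section PeriodicField.
Variables (R : realType) (S : translation_surface R).

Definition periodic_slopes : set R :=
  [set l | alg_periodic S (vec2 1 l)].

Definition normalized : Prop :=
  [/\ alg_periodic S (vec2 1 0), alg_periodic S (vec2 1 1)
    & alg_periodic S (vec2 0 1)].

Definition three_periodic_directions : Prop :=
  exists u v w : 'rV[R]_2,
    [/\ alg_periodic S u, alg_periodic S v & alg_periodic S w] /\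
    [/\ det2 u v != 0, det2 v w != 0 & det2 w u != 0].

End PeriodicField.

(* K is the set of finite slopes of algebraically periodic directions in all
   normalized coordinates; these exist as there are three periodic directions. *)
Definition is_periodic_direction_field (R : realType)
    (S : translation_surface R) (K : set R) : Prop :=
  three_periodic_directions S /\
  forall (g : 'M[R]_2) (gU : g \in unitmx),
    normalized (transform S gU) -> periodic_slopes (transform S gU) = K.

Section Cells.
Variables (R : realType) (cell : finType) (corner : cell -> 'I_3 -> 'rV[R]_2).
Implicit Types (t : cell) (e f : cell * 'I_3) (x : 'rV[R]_2).

Definition edge t k : 'rV[R]_2 := corner t (k + 1) - corner t k.

(* For corners in counterclockwise order, the open and the closed triangle. *)
Definition in_open t x : Prop := forall k, 0 < det2 (edge t k) (x - corner t k).
Definition in_closed t x : Prop := forall k, 0 <= det2 (edge t k) (x - corner t k).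

(* [e] and [f] are the same segment with its two orientations. *)
Definition opposed e f : bool :=
  (corner e.1 e.2 == corner f.1 (f.2 + 1)) &&
  (corner e.1 (e.2 + 1) == corner f.1 f.2).

Definition mate e : option (cell * 'I_3) := [pick f | opposed e f].

Definition boundary e : bool := ~~ [exists f, opposed e f].

Definition horizontal e : bool := edge e.1 e.2 0 1 == 0.
Definition vertical e : bool := edge e.1 e.2 0 0 == 0.

End Cells.

(* A compact connected polygonal region, given by an edge-to-edge triangulation:
   the region is the union of the closed triangles [cell].  The triangles have
   disjoint interiors, and a vertex lies in a closed triangle only as one of its
   corners, so that two triangles meet along a common vertex or side, if at all.
   A side of a triangle lies on the boundary of the region iff no other triangle
   has it as a side.  By [boundary_simple] the boundary is a disjoint union of
   simple closed polygons.  All angles are multiples of pi/2, and the region is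
   rotated so that its sides are horizontal or vertical. *)
Record right_angled_table (R : realType) := RightAngledTable {
  cell : finType;
  corner : cell -> 'I_3 -> 'rV[R]_2;
  cell_nonempty : (0 < #|cell|)%N;
  cell_ccw : forall t, 0 < det2 (edge corner t 0) (edge corner t 1);
  cell_disjoint : forall s t x,
    in_open corner s x -> in_open corner t x -> s = t;
  cell_edge_to_edge : forall s t k,
    in_closed corner s (corner t k) -> exists l, corner t k = corner s l;
  cell_connected : forall s t,
    connect [rel x y | [exists k, [exists l, opposed corner (x, k) (y, l)]]] s t;
  boundary_simple : forall e f, boundary corner e -> boundary corner f ->
    corner e.1 e.2 = corner f.1 f.2 -> e = f;
  boundary_axis : forall e, boundary corner e ->
    horizontal corner e || vertical corner e
}.

Section Unfolding.
Variables (R : realType) (P : right_angled_table R).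
Notation corner := (@corner R P).
Notation edge := (edge corner).
Notation opposed := (opposed corner).
Notation mate := (mate corner).
Notation boundary := (boundary corner).
Notation horizontal := (horizontal corner).
Notation vertical := (vertical corner).

(* The group generated by the reflections in the axes: r.1 tells whether the
   first coordinate changes sign, and r.2 whether the second one does. *)
Definition reflect2 (r : bool * bool) (v : 'rV[R]_2) : 'rV[R]_2 :=
  vec2 ((-1) ^+ r.1 * v 0 0) ((-1) ^+ r.2 * v 0 1).

Definition reversing (r : bool * bool) : bool := r.1 (+) r.2.

(* Compose r with the reflection in the direction of the boundary side e. *)
Definition reflect_in (e : cell P * 'I_3) (r : bool * bool) : bool * bool :=
  if horizontal e then (r.1, ~~ r.2) else (~~ r.1, r.2).

Definition unfold_face : finType := (cell P * (bool * bool))%type.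

(* The side k of the copy (t, r) is the image of the side
   [flip (reversing r) k] of t, run backwards if r reverses orientation. *)
Definition unfold_side (x : unfold_face) (k : 'I_3) : 'rV[R]_2 :=
  let b := reversing x.2 in
  (-1) ^+ b *: reflect2 x.2 (edge x.1 (flip b k)).

Definition unfold_glue (x : unfold_face * 'I_3) : unfold_face * 'I_3 :=
  let: ((t, r), k) := x in
  let e := (t, flip (reversing r) k) in
  if mate e is Some f then ((f.1, r), flip (reversing r) f.2)
  else let r' := reflect_in e r in ((t, r'), flip (reversing r') e.2).

Lemma edge_sum t : \sum_k edge t k = 0.
Proof.
rewrite sumrB; apply/eqP; rewrite subr_eq0; apply/eqP.
by rewrite [RHS](reindex_inj (addIr (1 : 'I_3))).
Qed.

Lemma edge_ccw t k : 0 < det2 (edge t k) (edge t (k + 1)).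
Proof. by rewrite (det2_side _ (edge_sum t)) cell_ccw. Qed.

Lemma opposed_sym e f : opposed e f = opposed f e.
Proof. by rewrite /opposed andbC [in RHS]eq_sym [X in _ && X]eq_sym. Qed.

Lemma small_param (B p q : R) : 0 < B ->
  exists2 d, 0 < d < 1 & (0 < B + d * p) && (0 < B + d * q).
Proof.
move=> B0; pose D := 2 * (B + `|p| + `|q|).
have p0 := normr_ge0 p; have q0 := normr_ge0 q.
have D0 : 0 < D by rewrite /D; lra.
exists (B / D); first by rewrite divr_gt0 //= ltr_pdivrMr // /D; lra.
have hp : - `|p| <= p by rewrite lerNl -normrN ler_norm.
have hq : - `|q| <= q by rewrite lerNl -normrN ler_norm.
have E r : B + B / D * r = (B / D) * (D + r).
  by field; rewrite gt_eqF.
have BD : 0 < B / D by rewrite divr_gt0.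
by rewrite !E !(pmulr_rgt0 _ BD); apply/andP; split; rewrite /D; lra.
Qed.

Lemma same_side (s t : cell P) k l :
  corner s k = corner t l -> corner s (k + 1) = corner t (l + 1) -> s = t.
Proof.
move=> h0 h1; have k3 (j : 'I_3) : j + 1 + 1 + 1 = j.
  by apply/val_inj; case: j => [[|[|[|]]]].
have A := edge_ccw s k; have B := edge_ccw t l.
move: A B; rewrite /edge -h0 -h1.
set a := corner s k; set b := corner s (k + 1).
set c := corner s (k + 1 + 1); set d := corner t (l + 1 + 1) => A B.
pose m := 2^-1 *: (a + b).
pose p := det2 (d - b) (c - m); pose q := det2 (a - d) (c - m).
have B2 : 0 < det2 (b - a) (d - b) / 2 by lra.
have [z /andP[z0 z1] /andP[zp zq]] := small_param p q B2.
pose x := m + z *: (c - m).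
apply: (@cell_disjoint R P s t x).
  apply: (ord3P (k := k)); rewrite /Defs.edge ?k3 -/a -/b -/c.
  - rewrite (_ : det2 _ _ = z * det2 (b - a) (c - b)) ?mulr_gt0 //.
    by rewrite /x /m /det2 !mxE; field.
  - rewrite (_ : det2 _ _ = (1 - z) / 2 * det2 (b - a) (c - b)); last first.
      by rewrite /x /m /det2 !mxE; field.
    by rewrite mulr_gt0 //; lra.
  - rewrite (_ : det2 _ _ = (1 - z) / 2 * det2 (b - a) (c - b)); last first.
      by rewrite /x /m /det2 !mxE; field.
    by rewrite mulr_gt0 //; lra.
apply: (ord3P (k := l)); rewrite /Defs.edge ?k3 -?h0 -?h1 -/a -/b -/d.
- rewrite (_ : det2 _ _ = z * det2 (b - a) (c - b)) ?mulr_gt0 //.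
  by rewrite /x /m /det2 !mxE; field.
- rewrite (_ : det2 _ _ = det2 (b - a) (d - b) / 2 + z * p) //.
  by rewrite /p /x /m /det2 !mxE; field.
- rewrite (_ : det2 _ _ = det2 (b - a) (d - b) / 2 + z * q) //.
  by rewrite /q /x /m /det2 !mxE; field.
Qed.

Lemma corner_inj t : injective (corner t).
Proof.
move=> k l; have := edge_ccw t l; move: k; apply: (@ord3P _ l) => //.
  by move=> + h; rewrite /edge h subrr /det2 !mxE !mul0r subrr ltxx.
move=> + h; rewrite /edge h (_ : det2 _ _ = 0) ?ltxx //.
by rewrite /det2 !mxE; ring.
Qed.

Lemma opposed_inj e f f' : opposed e f -> opposed e f' -> f = f'.
Proof.
case: f f' => [s k] [t l] /andP[/eqP h0 /eqP h1] /andP[/eqP h2 /eqP h3].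
have st : s = t by apply: (@same_side s t k l); rewrite /= -?h1 -?h0.
by move: h1 h3; rewrite -st /= => -> /corner_inj->.
Qed.

Lemma mateP e f : reflect (mate e = Some f) (opposed e f).
Proof.
rewrite /mate; case: pickP => [f' ef'|n]; last first.
  by rewrite n; constructor.
by apply: (iffP idP) => [/opposed_inj-/(_ _ ef')->|[<-]].
Qed.

Lemma boundaryP e : reflect (mate e = None) (boundary e).
Proof.
rewrite /mate /boundary; case: pickP => [f ef|n].
  by apply: (iffP idP) => // /negP[]; apply/existsP; exists f.
by apply: (iffP idP) => // _; apply/existsP => -[f]; rewrite n.
Qed.

Lemma reflect2D r u v : reflect2 r (u + v) = reflect2 r u + reflect2 r v.
Proof. by apply: vec2P; rewrite !mxE /= mulrDr. Qed.

Lemma reflect2_0 r : reflect2 r 0 = 0.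
Proof. by apply: vec2P; rewrite !mxE /= mulr0. Qed.

Lemma reflect2N r u : reflect2 r (- u) = - reflect2 r u.
Proof. by apply: vec2P; rewrite !mxE /= mulrN. Qed.

Lemma det2_reflect r u v :
  det2 (reflect2 r u) (reflect2 r v) = (-1) ^+ reversing r * det2 u v.
Proof. by rewrite /det2 !mxE /= signr_addb; ring. Qed.

Lemma unfold_nonempty : (0 < #|unfold_face|)%N.
Proof. by rewrite !card_prod card_bool !muln_gt0 cell_nonempty. Qed.

Lemma unfold_sum x : \sum_k unfold_side x k = 0.
Proof.
rewrite /unfold_side -scaler_sumr.
rewrite (sum_flip _ (fun k => reflect2 x.2 (edge x.1 k))).
by rewrite -(big_morph _ (reflect2D x.2) (reflect2_0 x.2)) edge_sum reflect2_0 scaler0.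
Qed.

Lemma unfold_ccw x : 0 < det2 (unfold_side x 0) (unfold_side x 1).
Proof.
rewrite /unfold_side det2Z sqrr_sign mul1r det2_reflect.
case: (reversing _); rewrite /flip; last by rewrite mul1r cell_ccw.
rewrite oppr0 expr1 mulN1r -det2C.
by have := edge_ccw x.1 (- 1); rewrite addNr.
Qed.

Lemma reflect_inK e : involutive (reflect_in e).
Proof.
by case=> r1 r2; rewrite /reflect_in; case: (horizontal e); rewrite /= negbK.
Qed.

Lemma unfold_glueK : involutive unfold_glue.
Proof.
case=> [[t r] k] /=; set e := (t, _).
case E: (mate e) => [[s l]|] /=; rewrite flipK.
  have /mateP : opposed (s, l) e by rewrite opposed_sym; apply/mateP.
  by move=> -> /=; rewrite flipK.
by rewrite -/e E reflect_inK /e /= flipK.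
Qed.

Lemma unfold_side_glue x :
  unfold_side (unfold_glue x).1 (unfold_glue x).2 = - unfold_side x.1 x.2.
Proof.
case: x => [[t r] k] /=; set e := (t, _).
case E: (mate e) => [[s l]|] /=.
  have /andP[/eqP h0 /eqP h1] : opposed e (s, l) by apply/mateP.
  rewrite /unfold_side /= flipK -scalerN -reflect2N.
  by rewrite /edge /= in h0 h1 *; rewrite -h0 -h1 opprB.
have := boundary_axis (introT (boundaryP e) E).
rewrite /unfold_side /= flipK /reflect_in /horizontal /vertical /=.
case: r @e E => r1 r2 e E /=; rewrite /reversing /=.
move: (edge t _) => w; case: ifP => [/eqP h _|_ /= /eqP h];
  by apply: vec2P; rewrite !mxE /= ?h ?addNb ?addbN ?signrN; ring.
Qed.

Lemma unfold_interior r s t :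
  connect [rel x y | [exists k, (unfold_glue (x, k)).1 == y]] (s, r) (t, r).
Proof.
have /connectP[p + ->] := cell_connected s t.
elim: p s => [|u p IHp] s /=; first by rewrite connect0.
case/andP=> /existsP[k /existsP[l ekl]] /IHp; apply: connect_trans.
apply/connect1/existsP; exists (flip (reversing r) k).
by rewrite /= flipK (elimT (mateP _ _) ekl) /=.
Qed.

(* Green's formula: a function antisymmetric under reversal of the edges sums
   to zero over the sides of all triangles if it vanishes on the boundary. *)
Lemma sum_edges (F : 'rV[R]_2 -> 'rV[R]_2 -> R) :
  (forall x y, F x y = - F y x) ->
  (forall e, boundary e -> F (corner e.1 e.2) (corner e.1 (e.2 + 1)) = 0) ->
  \sum_e F (corner e.1 e.2) (corner e.1 (e.2 + 1)) = 0.
Proof.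
move=> anti F0; pose G e := F (corner e.1 e.2) (corner e.1 (e.2 + 1)).
pose m e := odflt e (mate e).
have mK : involutive m.
  move=> e; rewrite /m; case E: (mate e) => [f|] /=; last by rewrite E.
  have /mateP-> // : opposed f e by rewrite opposed_sym; apply/mateP.
have GN e : G (m e) = - G e.
  rewrite /m; case E: (mate e) => [f|] /=.
    have /andP[/eqP h0 /eqP h1] : opposed e f by apply/mateP.
    by rewrite /G h0 h1 -anti.
  by rewrite /G F0 ?oppr0 //; apply/boundaryP.
suff: \sum_e G e = - \sum_e G e.
  by rewrite /G; lra.
rewrite [LHS](reindex_inj (can_inj mK)) -sumrN.
by apply: eq_bigr => e _; rewrite GN.
Qed.

Lemma boundary_direction (i : 'I_2) :
  exists2 e, boundary e & edge e.1 e.2 0 i != 0.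
Proof.
apply: contrapT => nb.
pose F (x y : 'rV[R]_2) := (x 0 (1 - i) + y 0 (1 - i)) * (y 0 i - x 0 i).
have F0 e : boundary e -> F (corner e.1 e.2) (corner e.1 (e.2 + 1)) = 0.
  move=> eb; rewrite /F; apply/eqP; rewrite mulf_eq0; apply/orP; right.
  apply/negPn/negP => ne; apply: nb; exists e => //.
  by rewrite /edge !mxE.
have := sum_edges (F := F) (fun x y => ltac:(rewrite /F; ring)) F0.
rewrite -(pair_bigA _ (fun t k => F (corner t k) (corner t (k + 1)))) /=.
have Ft t : \sum_k F (corner t k) (corner t (k + 1)) =
            (-1) ^+ (i == 0) * det2 (edge t 0) (edge t 1).
  rewrite !big_ord_recl big_ord0 addr0 /edge.
  rewrite (_ : lift ord0 (lift ord0 ord0) = 1 + 1 :> 'I_3); last exact/val_inj.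
  rewrite (_ : lift ord0 ord0 = 1 :> 'I_3); last exact/val_inj.
  rewrite (_ : 1 + 1 + 1 = 0 :> 'I_3); last exact/val_inj.
  rewrite add0r /F /det2 !mxE.
  have [->|i1] := eqVneq i 0; rewrite ?subr0 ?expr1 ?expr0; first by ring.
  have -> : i = 1 by case: i i1 {F nb F0} => [[|[|//]] ?] // _; exact/val_inj.
  by rewrite subrr; ring.
rewrite (eq_bigr _ (fun t _ => Ft t)) -mulr_sumr => /eqP.
rewrite mulf_eq0 signr_eq0 /= => /eqP h.
have /card_gt0P[t _] := cell_nonempty P.
have: 0 < \sum_t det2 (edge t 0) (edge t 1).
  rewrite (bigD1 t) //= ltr_wpDr ?cell_ccw //.
  by apply: sumr_ge0 => s _; apply/ltW/cell_ccw.
by rewrite h ltxx.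
Qed.

Lemma unfold_connected x y :
  connect [rel x y | [exists k, (unfold_glue (x, k)).1 == y]] x y.
Proof.
set C := connect _.
have cross e r t : boundary e -> C (t, r) (t, reflect_in e r).
  move=> eb; apply: connect_trans (unfold_interior r t e.1) _.
  apply: connect_trans (unfold_interior _ e.1 t).
  apply/connect1/existsP; exists (flip (reversing r) e.2).
  by rewrite /= flipK -surjective_pairing (elimT (boundaryP e) eb) /=.
have flip1 r t : C (t, r) (t, (~~ r.1, r.2)).
  have [e eb en] := boundary_direction 1.
  by have := cross e r t eb; rewrite /reflect_in /horizontal (negPf en).
have flip2 r t : C (t, r) (t, (r.1, ~~ r.2)).
  have [e eb en] := boundary_direction 0.
  have := cross e r t eb; rewrite /reflect_in.
  by have := boundary_axis eb; rewrite /vertical (negPf en) orbF => ->.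
have all r r' t : C (t, r) (t, r').
  case: r r' => [a b] [a' b']; apply: (@connect_trans _ _ (t, (a', b))).
    have [->|] := eqVneq a a'; first exact: connect0.
    by case: a a' => [] [] // _; apply: (flip1 (_, _)).
  have [->|] := eqVneq b b'; first exact: connect0.
  by case: b b' => [] [] // _; apply: (flip2 (_, _)).
case: x y => [s r] [t r'].
exact: connect_trans (unfold_interior r s t) (all r r' t).
Qed.

Definition unfolding : translation_surface R :=
  TranslationSurface unfold_nonempty unfold_sum unfold_ccw
    unfold_glueK unfold_side_glue unfold_connected.

End Unfolding.

(* Main.v *)
(* For a surface made of a_i x b_i rectangles, J vanishes in the direction of
   slope l iff the sum of the (l a_i) /\ b_i is 0.  If theta generates K and f is
   its minimal polynomial, the value t of (f(X) - f(Y)) / (X - Y) at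
   X = theta (x) 1, Y = 1 (x) theta is a symmetric tensor in K (x) K with
   (l (x) 1) t = (1 (x) l) t for all l in K, so every l in K is a slope; as t is
   moreover nondegenerate, no other slope occurs.  Multiplication sends t to
   f'(theta), which is not 0; up to sign, t has positive area, and then shears
   by rational numbers turn it into a sum of a (x) b with a, b > 0.  Sorted by
   height, these rectangles are the columns of a staircase-shaped table.  Its
   unfolding has holonomy in K^2, so it is completely algebraically periodic. *)
From HB Require Import structures.
Require Import Defs.
From mathcomp Require Import all_boot all_order all_algebra.
From mathcomp Require Import falgebra fieldext separable polyorder.
From mathcomp Require Import finmap boolp classical_sets reals.
From mathcomp Require Import monalg.
From mathcomp Require Import ring lra zify.

Set Implicit Arguments.
Unset Strict Implicit.
Unset Printing Implicit Defensive.

Import Order.TTheory GRing.Theory Num.Theory.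

Local Open Scope classical_set_scope.
Local Open Scope quotient_scope.
Local Open Scope ring_scope.

(** * Positive tensors *)

(** The area is the image of the tensor under multiplication, so it does not depend on the
    rectangles chosen to represent it. Rectangles with positive sides have positive area, and the
    shears show that no other condition stands in the way. A slope outside K is excluded by a
    Q-linear map from the reals to Q that vanishes on K but not at that slope: it turns the
    vanishing of SAF into an identity inside K that contradicts nondegeneracy. SAF depends only on
    the tensor, so it is computed on the staircase but analysed on the original tensor, whose
    algebraic form the shears destroy. The definition of the field admits every real change of
    coordinates, not only those over K; three directions known to be defined over K are enough to
    control them. *)

Section Tensor.
Variable K : fieldExtType rat.
Implicit Types (L P : seq (K * K)) (V : zmodType).

(** The target is a bare abelian group, because [wedge_square] carries no rational scaling; moving a
    rational from one argument to the other is all that a tensor product over Q demands. *)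
Record balanced V (f : K -> K -> V) : Prop := Balanced {
  balDl : forall a a' b, f (a + a') b = f a b + f a' b;
  balDr : forall a b b', f a (b + b') = f a b + f a b';
  balZ : forall (q : rat) a b, f (q *: a) b = f a (q *: b)
}.

Definition teval V (f : K -> K -> V) L : V := \sum_(x <- L) f x.1 x.2.

(* Equality of the elements [\sum_(x <- L) x.1 (x) x.2] of the tensor square of
   K over Q, phrased through the universal property. *)
Definition teq L L' : Prop :=
  forall V (f : K -> K -> V), balanced f -> teval f L = teval f L'.

Lemma teq_trans L1 L2 L3 : teq L1 L2 -> teq L2 L3 -> teq L1 L3.
Proof. by move=> h h' V f fb; rewrite h // h'. Qed.

Lemma teval_cons V (f : K -> K -> V) x L :
  teval f (x :: L) = f x.1 x.2 + teval f L.
Proof. by rewrite /teval big_cons. Qed.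

Lemma teq_cons x L L' : teq L L' -> teq (x :: L) (x :: L').
Proof. by move=> h V f fb; rewrite !teval_cons h. Qed.

Lemma teq_perm L L' : perm_eq L L' -> teq L L'.
Proof. by move=> h V f _; apply: perm_big. Qed.

Lemma teq_cat N L L' : teq L L' -> teq (N ++ L) (N ++ L').
Proof. by move=> h V f fb; rewrite /teval !big_cat /= -!/(teval f _) h. Qed.

Section Balanced.
Variables (V : zmodType) (f : K -> K -> V) (fb : balanced f).

Lemma bal0l b : f 0 b = 0.
Proof. by apply: (addrI (f 0 b)); rewrite -balDl // !addr0. Qed.

Lemma bal0r a : f a 0 = 0.
Proof. by apply: (addrI (f a 0)); rewrite -balDr // !addr0. Qed.

Lemma balNl a b : f (- a) b = - f a b.
Proof. by apply/eqP; rewrite -addr_eq0 -balDl // addNr bal0l. Qed.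

Lemma balNr a b : f a (- b) = - f a b.
Proof. by apply/eqP; rewrite -addr_eq0 -balDr // addNr bal0r. Qed.

Lemma bal_suml I (r : seq I) (F : I -> K) b :
  f (\sum_(i <- r) F i) b = \sum_(i <- r) f (F i) b.
Proof. by elim/big_rec2: _ => [|i u v _ <-]; rewrite ?bal0l ?balDl. Qed.

Lemma bal_sumr I (r : seq I) (F : I -> K) a :
  f a (\sum_(i <- r) F i) = \sum_(i <- r) f a (F i).
Proof. by elim/big_rec2: _ => [|i u v _ <-]; rewrite ?bal0r ?balDr. Qed.

End Balanced.

(** The term a ⊗ qd = qa ⊗ d is cut off the first rectangle and attached to the second. *)
Lemma teq_shear (q : rat) a b c d L :
  teq ((a, b) :: (c, d) :: L)
      ((a, b - q *: d) :: (c + q *: a, d) :: L).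
Proof.
move=> V f fb; rewrite !teval_cons /= !addrA; congr (_ + _).
by rewrite balDr // balDl // balNr // balZ // [f c d + _]addrC addrA addrNK.
Qed.

Section Positive.
Variables (R : realType) (iota : {rmorphism K -> R}).

Lemma alg_ratr (q : rat) : q%:A = ratr q :> K.
Proof.
rewrite -[q in LHS]divq_num_den -in_algE fmorph_div.
by rewrite !(rmorph_int (in_alg K)).
Qed.

Lemma rmorphZ_rat (q : rat) (a : K) : iota (q *: a) = ratr q * iota a.
Proof. by rewrite -mulr_algl rmorphM /= alg_ratr fmorph_rat. Qed.

Definition area L : R := \sum_(x <- L) iota x.1 * iota x.2.

Lemma area_cons x L : area (x :: L) = iota x.1 * iota x.2 + area L.
Proof. by rewrite /area big_cons. Qed.

Lemma area_balanced : balanced (fun a b => iota a * iota b).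
Proof.
split=> [a a' b|a b b'|q a b]; rewrite ?rmorphD ?mulrDl ?mulrDr //.
by rewrite !rmorphZ_rat; ring.
Qed.

Lemma teq_area L L' : teq L L' -> area L = area L'.
Proof. exact: (fun h => h _ _ area_balanced). Qed.

Lemma area_cat L L' : area (L ++ L') = area L + area L'.
Proof. exact: big_cat. Qed.

Definition pos_pair (x : K * K) : bool := (0 < iota x.1) && (0 < iota x.2).

(* The rectangle p gives area to x by a rational shear, keeping enough for both
   p and the remaining sum to stay positive. *)
Lemma absorb x P : 0 < iota x.2 -> all pos_pair P -> 0 < area (x :: P) ->
  exists2 P', teq (x :: P) P' & all pos_pair P'.
Proof.
elim: P x => [|[a b] P IHP] [c d] /= d0.
  rewrite area_cons /area big_nil addr0 pmulr_lgt0 // => _ c0.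
  by exists [:: (c, d)] => //=; rewrite /pos_pair /= c0 d0.
case/andP=> /andP[/= a0 b0] posP; rewrite !area_cons /= => A0.
(* The upper bound on q keeps [b - q *: d] positive, the lower bound keeps the area of
   [(c + q *: a, d) :: P] positive; the interval is nonempty exactly because the total area is
   positive. *)
have: - (iota c * iota d + area P) / (iota a * iota d) < iota b / iota d.
  rewrite ltr_pdivrMr ?mulr_gt0 //.
  rewrite (_ : iota b / iota d * _ = iota a * iota b); first by lra.
  by field; rewrite gt_eqF.
case/rat_in_itvoo=> q; rewrite in_itv /= ltr_pdivrMr ?mulr_gt0 // ltr_pdivlMr //.
case/andP=> q1 q2.
have [|P' hP' posP'] := IHP (c + q *: a, d) d0 posP.
  by rewrite area_cons /= rmorphD /= rmorphZ_rat; lra.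
exists ((a, b - q *: d) :: P').
  apply: (@teq_trans _ [:: (a, b), (c, d) & P]).
    by apply: teq_perm; rewrite (perm_catCA [:: (c, d)] [:: (a, b)] P).
  by apply: teq_trans (teq_shear q _ _ _ _ _) _; apply: teq_cons.
by rewrite /= posP' /pos_pair /= a0 rmorphB rmorphZ_rat subr_gt0 q2.
Qed.

(** The terms can be absorbed one at a time: those still waiting have nonpositive area, so the
    current one together with the positive rectangles has positive area. *)
Lemma absorb_all N P : all (fun x => (iota x.1 <= 0) && (0 < iota x.2)) N ->
  all pos_pair P -> 0 < area (N ++ P) ->
  exists2 P', teq (N ++ P) P' & all pos_pair P'.
Proof.
elim: N P => [|x N IHN] P /=; first by exists P.
case/andP=> /andP[x1 x2] hN posP; rewrite area_cons => A0.
have AN : area N <= 0.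
  rewrite /area big_seq; apply: sumr_le0 => y /(allP hN) /andP[? ?].
  by rewrite mulr_le0_ge0 // ltW.
have [|P1 e1 pos1] := absorb x2 posP.
  by move: A0; rewrite area_cons area_cat; lra.
have [|P2 e2 pos2] := IHN P1 hN pos1.
  by move: A0; rewrite area_cat area_cat -(teq_area e1) area_cons; lra.
exists P2 => //; apply: teq_trans e2; apply: teq_trans (teq_cat N e1).
by apply: teq_perm; rewrite (perm_catCA [:: x] N P).
Qed.

Theorem positive_tensor L : 0 < area L -> exists2 P, teq L P & all pos_pair P.
Proof.
(* As (-a) ⊗ (-b) = a ⊗ b and a ⊗ 0 = 0, all second entries may be taken positive; only first
   entries can then have the wrong sign. *)
pose s (x : K * K) := if iota x.2 < 0 then (- x.1, - x.2) else x.
pose L1 := [seq s x | x <- L & x.2 != 0].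
have e1 : teq L L1.
  move=> V f fb; rewrite /teval big_map big_filter [LHS](bigID (fun x => x.2 != 0)) /=.
  rewrite [X in _ + X]big1 ?addr0 => [|x /negbNE/eqP->]; last by rewrite bal0r.
  by apply: eq_bigr => x _; rewrite /s; case: ifP => //= _; rewrite balNl ?balNr ?opprK.
have pos2 : all (fun x => 0 < iota x.2) L1.
  apply/allP => _ /mapP[x + ->]; rewrite mem_filter => /andP[x0 _].
  rewrite /s; case: ifP => [h|/negbT] /=; first by rewrite rmorphN oppr_gt0.
  by rewrite -leNgt le_eqVlt eq_sym fmorph_eq0 (negPf x0).
rewrite (teq_area e1) => A0; pose p (x : K * K) := iota x.1 <= 0.
have e2 : teq L1 ([seq x <- L1 | p x] ++ [seq x <- L1 | predC p x]).
  by apply: teq_perm; rewrite perm_sym (permEl (perm_filterC p L1)).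
have [||| P e3 posP] := @absorb_all [seq x <- L1 | p x] [seq x <- L1 | predC p x].
- by apply/allP => x; rewrite mem_filter => /andP[px xL]; rewrite (allP pos2) // andbT.
- apply/allP => x; rewrite mem_filter => /andP[/= px xL].
  by rewrite /pos_pair (allP pos2) // andbT ltNge.
- by rewrite -(teq_area e2).
by exists P => //; exact: teq_trans (teq_trans e1 e2) e3.
Qed.

End Positive.
End Tensor.

(** * The symmetric tensor of a number field *)

Section Primitive.
Variable K : fieldExtType rat.

Lemma horner_alg_coef (x : K) (p : {poly rat}) n : (size p <= n)%N ->
  horner_alg x p = \sum_(k < n) p`_k *: x ^+ k.
Proof.
move=> pn; rewrite [LHS](@horner_coef_wide _ n) ?size_map_poly //.
by apply: eq_bigr => k _; rewrite coef_map /= mulr_algl.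
Qed.

Lemma primitive_polynomial : exists (theta : K) (f : {poly rat}),
  [/\ forall l, exists p : {poly rat}, l = horner_alg theta p,
      horner_alg theta f = 0, f != 0
    & forall p : {poly rat}, (size p < size f)%N -> horner_alg theta p = 0 -> p = 0].
Proof.
have sepK : separable 1%AS {:K}%AS.
  apply/separableP => y _; apply: pcharf0_separable.
  by move=> q; rewrite pchar_lalg; apply: pchar_num.
have genK := eq_adjoin_separable_generator sepK (sub1v _).
set z := separable_generator _ _ in genK; pose m := minPoly 1%AS z.
have horE (p : {poly rat}) : (map_poly (in_alg K) p).[z] = horner_alg z p by [].
have /polyOver1P[f fE] := minPolyOver 1%AS z.
exists z, f; split.
- move=> l; have: l \in <<1%AS; z>>%VS by rewrite -genK memvf.
  by case/Fadjoin_polyP => _ /polyOver1P[p ->] ->; exists p.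
- by rewrite -horE -fE; apply/rootP/root_minPoly.
- by rewrite -(map_poly_eq0 (in_alg K)) -fE monic_neq0 ?monic_minPoly.
move=> p pf; rewrite -horE => /rootP pz; apply/eqP/negPn/negP => p0.
have p0' : map_poly (in_alg K) p != 0 by rewrite map_poly_eq0.
have := dvdp_leq p0' (minPoly_dvdp (alg_polyOver 1%AS p) pz).
by rewrite fE !size_map_poly leqNgt pf.
Qed.

End Primitive.

Section Euler.
Variables (K : fieldExtType rat) (theta : K) (f : {poly rat}).
Hypothesis f_theta : horner_alg theta f = 0.

(** The intermediate values of Horner's scheme. The coefficient of Y^k in the quotient of f(X) -
    f(Y) by X - Y is [drop_poly k.+1 f], as a polynomial in X. *)
Let g k := horner_alg theta (drop_poly k f).

(* [f(X) - f(Y)] divided by [X - Y], evaluated at [X = theta (x) 1] and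
   [Y = 1 (x) theta]. *)
Definition euler_tensor : seq (K * K) :=
  [seq (g k.+1, theta ^+ k) | k <- iota 0 (size f)].

Lemma teval_euler (V : zmodType) (h : K -> K -> V) :
  teval h euler_tensor = \sum_(k < size f) h (g k.+1) (theta ^+ k).
Proof. by rewrite /teval big_map -{1}[size f]subn0 big_mkord. Qed.

Lemma euler_horner k : g k = f`_k *: 1 + theta * g k.+1.
Proof.
rewrite /g; have -> : drop_poly k f = (f`_k)%:P + 'X * drop_poly k.+1 f.
  apply/polyP => i; rewrite !coefE.
  by case: i => [|i] /=; rewrite ?addr0 ?add0r ?addnS ?addSn ?add0n.
by rewrite rmorphD rmorphM /= horner_algX horner_algC.
Qed.

(** The coefficients depend on j + k only: this Hankel shape is the symmetry of the tensor. *)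
Lemma euler_coef k : g k.+1 = \sum_(j < size f) f`_(j + k.+1) *: theta ^+ j.
Proof.
rewrite /g (@horner_alg_coef _ _ _ (size f)); last first.
  by rewrite size_drop_poly leq_subr.
by apply: eq_bigr => j _; rewrite coef_drop_poly.
Qed.

(** On the diagonal Y = X the difference quotient becomes the derivative. *)
Lemma sum_euler : \sum_(k < size f) g k.+1 * theta ^+ k = horner_alg theta f^`().
Proof.
rewrite (eq_bigr (fun k : 'I_(size f) =>
  horner_alg theta (drop_poly k.+1 f * 'X^k))); last first.
  by move=> k _; rewrite rmorphM rmorphXn /= horner_algX.
rewrite -rmorph_sum; congr horner_alg; apply/polyP => i.
rewrite coef_sum coef_deriv /=.
have [fi|fi] := leqP (size f) i.
  rewrite nth_default ?mul0rn 1?leqW //; apply: big1 => k _.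
  rewrite coefMXn coef_drop_poly; case: ltnP => // ki.
  by rewrite nth_default // addnS subnK // leqW.
transitivity (\sum_(k < size f | (k < i.+1)%N) f`_i.+1).
  rewrite [RHS]big_mkcond /=; apply: eq_bigr => k _.
  rewrite coefMXn coef_drop_poly ltnS; case: ltnP => // ki.
  by rewrite addnS subnK.
by rewrite -(big_ord_widen _ (fun=> f`_i.+1) fi) sumr_const card_ord.
Qed.

Section Form.
Variables (V : zmodType) (h : K -> K -> V) (hb : balanced h).

(** Multiplying the tensor by X - Y gives f(X) - f(Y), and both terms vanish at theta. In
    coordinates this is a telescoping sum whose ends are [g 0], the value of f at theta, and
    [g (size f)], the value of the zero polynomial. *)
Lemma euler_move_theta :
  teval (fun a b => h (theta * a) b) euler_tensor =
  teval (fun a b => h a (theta * b)) euler_tensor.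
Proof.
apply/eqP; rewrite -subr_eq0 !teval_euler -sumrB.
have E k : h (theta * g k.+1) (theta ^+ k) - h (g k.+1) (theta * theta ^+ k) =
  (h (g k) (theta ^+ k) - h (g k.+1) (theta ^+ k.+1)) - h 1 (f`_k *: theta ^+ k).
  rewrite (euler_horner k) balDl // (balZ hb) exprS; set u := h 1 _.
  by rewrite -[u + _ - _]addrA [u + _]addrC addrK.
under eq_bigr => k _ do rewrite E.
rewrite sumrB -(bal_sumr hb) -horner_alg_coef // f_theta (bal0r hb) subr0.
rewrite -(big_mkord xpredT (fun k => h (g k) (theta ^+ k) - h (g k.+1) (theta ^+ k.+1))).
under eq_bigr => k _ do rewrite -opprB.
rewrite sumrN telescope_sumr // /g drop_poly0l f_theta (bal0l hb) subr0.
by rewrite drop_poly_eq0 // rmorph0 (bal0l hb) oppr0.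
Qed.

Lemma euler_swap :
  teval h euler_tensor = teval (fun a b => h b a) euler_tensor.
Proof.
rewrite !teval_euler.
transitivity (\sum_(k < size f) \sum_(j < size f)
  h (f`_(j + k.+1) *: theta ^+ j) (theta ^+ k)).
  by apply: eq_bigr => k _; rewrite euler_coef bal_suml.
rewrite exchange_big; apply: eq_bigr => j _; rewrite euler_coef (bal_sumr hb).
by apply: eq_bigr => k _; rewrite (balZ hb) addnS -addSn addnC.
Qed.

End Form.

Lemma balanced_mulr (V : zmodType) (h : K -> K -> V) l :
  balanced h -> balanced (fun a b => h a (l * b)).
Proof.
case=> hl hr hz; split=> *; rewrite ?mulrDr ?hl ?hr //.
by rewrite hz scalerAr.
Qed.

Lemma balanced_mull (V : zmodType) (h : K -> K -> V) l :
  balanced h -> balanced (fun a b => h (l * a) b).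
Proof.
case=> hl hr hz; split=> *; rewrite ?mulrDr ?hl ?hr //.
by rewrite -hz scalerAr.
Qed.

Lemma euler_move p (V : zmodType) (h : K -> K -> V) : balanced h ->
  teval (fun a b => h (horner_alg theta p * a) b) euler_tensor =
  teval (fun a b => h a (horner_alg theta p * b)) euler_tensor.
Proof.
(* [h] is generalised: the induction hypothesis is used for [h] with its second argument multiplied
   by theta. *)
elim/poly_ind: p V h => [|p c IHp] V h hb.
  rewrite rmorph0 /teval !big1 // => x _; rewrite mul0r; first exact: bal0r.
  exact: bal0l.
rewrite rmorphD rmorphM /= horner_algX horner_algC.
set l := horner_alg theta p.
transitivity (teval (fun a b => h (l * (theta * a)) b) euler_tensor +
              teval (fun a b => h (c *: a) b) euler_tensor).
  rewrite /teval -big_split; apply: eq_bigr => x _ /=.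
  by rewrite -balDl // mulrDl mulrA mulr_algl.
rewrite (euler_move_theta (balanced_mull l hb)) (IHp _ _ (balanced_mulr theta hb)).
rewrite /teval -big_split; apply: eq_bigr => x _ /=.
by rewrite (balZ hb) -(balDr hb) mulrDl mulr_algl mulrCA mulrA.
Qed.

(** Moving the multiplier across and then swapping the factors shows that the sum equals its own
    negative. Only its double is claimed to be 0, as [V] may have 2-torsion. *)
Lemma euler_alternating p (V : zmodType) (h : K -> K -> V) :
  balanced h -> (forall a, h a a = 0) ->
  teval (fun a b => h (horner_alg theta p * a) b) euler_tensor *+ 2 = 0.
Proof.
move=> hb h0; set l := horner_alg theta p.
have anti a b : h a b = - h b a.
  by have /eqP := h0 (a + b); rewrite balDl // !balDr // !h0 add0r addr0 addr_eq0 => /eqP.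
rewrite mulr2n {2}euler_move // (euler_swap (balanced_mulr l hb)).
rewrite /teval -big_split; apply: big1 => x _ /=.
by rewrite [X in _ + X]anti subrr.
Qed.

End Euler.

Section NumberField.
Variables (R : realType) (K : fieldExtType rat) (iota : {rmorphism K -> R}).

(** The last clause is nondegeneracy in the shape in which it is applied: for a functional a -> p(l
    a) it yields p(l) = 0. *)
Theorem symmetric_tensor : exists L : seq (K * K),
  [/\ 0 < area iota L,
      forall l (V : zmodType) (h : K -> K -> V), balanced h ->
        (forall a, h a a = 0) -> teval (fun a b => h (l * a) b) L *+ 2 = 0
    & forall p : K -> rat, (forall q a b, p (q *: a + b) = q * p a + p b) ->
        teval (fun a b => p a *: b) L = 0 -> p 1 = 0].
Proof.
have [theta [f [gen f_theta f0 f_min]]] := primitive_polynomial K.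
have f'0 : horner_alg theta f^`() != 0.
  have sf : (size f^`() < size f)%N by rewrite lt_size_deriv.
  apply: contra_neq f0 => /(f_min _ sf) /eqP.
  rewrite -size_poly_eq0 size_deriv -subn1 subn_eq0 => /size1_polyC fE.
  move: f_theta; rewrite fE horner_algC => /eqP.
  by rewrite scaler_eq0 oner_eq0 orbF => /eqP->.
pose L := euler_tensor theta f.
have areaL : area iota L = iota (horner_alg theta f^`()).
  rewrite -sum_euler rmorph_sum.
  apply: etrans (teval_euler _ _ (fun a b => iota a * iota b)) _.
  by apply: eq_bigr => k _; rewrite rmorphM.
have altL l (V : zmodType) (h : K -> K -> V) : balanced h -> (forall a, h a a = 0) ->
    teval (fun a b => h (l * a) b) L *+ 2 = 0.
  by have [p ->] := gen l; exact: euler_alternating.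
have lin0 (p : K -> rat) : (forall q a b, p (q *: a + b) = q * p a + p b) -> p 0 = 0.
  by move=> pl; have := pl (-1) 0 0; rewrite scaler0 addr0 mulN1r addNr.
have linZ (p : K -> rat) : (forall q a b, p (q *: a + b) = q * p a + p b) ->
    forall q a, p (q *: a) = q * p a.
  by move=> pl q a; rewrite -[q *: a]addr0 pl lin0 ?addr0.
have detL (p : K -> rat) : (forall q a b, p (q *: a + b) = q * p a + p b) ->
    teval (fun a b => p a *: b) L = 0 -> p 1 = 0.
  move=> pl; have pZ := linZ p pl; rewrite teval_euler; case Ef: (size f) => [|[|n]].
  - by move/eqP: Ef; rewrite size_poly_eq0 (negPf f0).
  - move/eqP/size_poly1P: Ef => [c c0 fE].
    move: f_theta; rewrite fE horner_algC => /eqP.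
    by rewrite scaler_eq0 oner_eq0 orbF (negPf c0).
  rewrite big_ord_recr /= [drop_poly n.+2 f]drop_poly_eq0 ?Ef // rmorph0 lin0 //.
  rewrite scale0r addr0 => S0.
  (* The hypothesis says that [G] vanishes at theta. Its degree is below that of f, so all its
     coefficients are 0; the top one is the leading coefficient of f times [p 1]. *)
  pose G := \poly_(k < n.+1) p (horner_alg theta (drop_poly k.+1 f)).
  have sG : (size G <= n.+1)%N := size_poly _ _.
  have G0 : G = 0.
    apply: f_min; first by rewrite Ef ltnS.
    rewrite (horner_alg_coef _ sG) -[RHS]S0; apply: eq_bigr => k _.
    by rewrite coef_poly ltn_ord.
  have : G`_n = 0 by rewrite G0 coef0.
  rewrite coef_poly ltnSn euler_horner drop_poly_eq0 ?Ef // rmorph0 mulr0 addr0 pZ.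
  move/eqP; rewrite mulf_eq0 => /orP[|/eqP//].
  by rewrite (_ : f`_n.+1 = lead_coef f) ?lead_coef_eq0 ?(negPf f0) // lead_coefE Ef.
have: iota (horner_alg theta f^`()) != 0 by rewrite fmorph_eq0.
case: ltgtP => // [neg|pos] _; last by exists L; split=> //; rewrite areaL.
exists [seq (- x.1, x.2) | x <- L]; split.
- rewrite /area big_map (eq_bigr (fun x => - (iota x.1 * iota x.2))).
    by rewrite sumrN -/(area iota L) areaL oppr_gt0.
  by move=> x _ /=; rewrite rmorphN mulNr.
- move=> l V h hb h0; rewrite -(altL (- l) V h hb h0) /teval big_map.
  by congr (_ *+ _); apply: eq_bigr => x _ /=; rewrite mulrN mulNr.
move=> p pl; rewrite /teval big_map => S0; apply: detL => //.
apply/eqP; rewrite -oppr_eq0 -sumrN; apply/eqP; rewrite -[RHS]S0.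
by apply: eq_bigr => x _ /=; rewrite -[- x.1]scaleN1r linZ // mulN1r scaleNr.
Qed.

End NumberField.

(** * Sorting rectangles into a staircase *)

Section Staircase.
Variables (R : realType) (K : fieldExtType rat) (iota : {rmorphism K -> R}).

(** Column i has width [w i] and height h_0 + ... + h_i, cut into one rectangle per row. *)
Definition staircase (w h : nat -> K) n : seq (K * K) :=
  [seq (w i, h j) | i <- index_iota 0 n, j <- index_iota 0 i.+1].

Lemma teval_staircase w h n (V : zmodType) (f : K -> K -> V) :
  teval f (staircase w h n) = \sum_(i < n) \sum_(j < n | (j <= i)%N) f (w i) (h j).
Proof.
rewrite /teval /staircase big_allpairs_dep big_mkord.
apply: eq_bigr => i _; rewrite big_mkord.
exact: (big_ord_widen _ (fun j => f (w i) (h j)) (ltn_ord i)).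
Qed.

(* The columns of the staircase are sorted by height, columns of the same height
   being merged; [h] lists the increments of the heights. *)
Lemma staircase_tensor P : all (pos_pair iota) P ->
  exists n w h, [/\ forall i, 0 < iota (w i), forall j, 0 < iota (h j)
    & teq P (staircase w h n)].
Proof.
move=> /allP posP; pose le (a b : K) := iota a <= iota b.
have le_tr : transitive le by move=> a b c; apply: le_trans.
have [S [uS memS sS]] : exists S, [/\ uniq S,
    forall b, (b \in S) = (b \in [seq x.2 | x <- P]) & sorted le S].
  exists (sort le (undup [seq x.2 | x <- P])); split.
  - by rewrite sort_uniq undup_uniq.
  - by move=> b; rewrite mem_sort mem_undup.
  - by apply: sort_sorted => a b; apply: le_total.
pose n := size S; pose s i := nth 0 S i.
(* The default 1 beyond n makes [w] and [h] positive at every index, so their partial sums increase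
   everywhere. *)
pose w i := if (i < n)%N then \sum_(x <- P | x.2 == s i) x.1 else 1.
pose h j := if (j < n)%N then (if j is k.+1 then s j - s k else s j) else 1.
have s_in i : (i < n)%N -> exists2 x, x \in P & x.2 = s i.
  move=> ni; have : s i \in [seq x.2 | x <- P] by rewrite -memS mem_nth.
  by case/mapP => x xP ->; exists x.
have sum_h i : (i < n)%N -> \sum_(j < i.+1) h j = s i.
  elim: i => [|i IHi] ni; first by rewrite big_ord1 /h ni.
  by rewrite big_ord_recr /= IHi ?(ltnW ni) // /h ni addrC subrK.
exists n, w, h; split.
- move=> i; rewrite /w; case: ifP => [ni|_]; last by rewrite rmorph1.
  have [x xP xs] := s_in i ni.
  rewrite rmorph_sum (big_rem x) //= xs eqxx ltr_wpDr //; last by case/andP: (posP x xP).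
  rewrite big_seq_cond; apply: sumr_ge0 => y /andP[/mem_rem yP _].
  by case/andP: (posP y yP) => /ltW.
- move=> j; rewrite /h; case: ifP => [nj|_]; last by rewrite rmorph1.
  case: j nj => [|j] nj.
    by have [x xP <-] := s_in 0%N nj; case/andP: (posP x xP).
  rewrite rmorphB subr_gt0 lt_neqAle (inj_eq (fmorph_inj iota)).
  rewrite (nth_uniq 0 (ltnW nj) nj uS) ltn_eqF //=.
  have le_refl : reflexive le by move=> a; apply: lexx.
  have : le (s j) (s j.+1).
    exact: (sorted_leq_nth le_tr le_refl 0 sS _ _ (ltnW nj) nj (leqnSn j)).
  by rewrite /le.
move=> V f fb; rewrite /teval /staircase big_allpairs_dep.
transitivity (\sum_(0 <= i < n) \sum_(x <- P | x.2 == s i) f x.1 (s i)).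
  rewrite -(big_nth 0 xpredT (fun b => \sum_(x <- P | x.2 == b) f x.1 b)).
  under [RHS]eq_bigr => b _ do rewrite big_mkcond.
  rewrite exchange_big; apply: eq_big_seq => x xP.
  rewrite (bigD1_seq x.2) ?memS ?map_f //= eqxx big1 ?addr0 // => b.
  by rewrite eq_sym => /negPf->.
apply: eq_big_seq => i; rewrite mem_index_iota => /andP[_ ni].
rewrite -(bal_sumr fb) big_mkord sum_h // /w ni.
by elim/big_rec2: _ => [|x u v _ ->]; rewrite ?(bal0l fb) // (balDl fb).
Qed.

End Staircase.

(** * Staircase tables *)

Section Table.
Variables (R : realType) (n : nat) (n_gt0 : (0 < n)%N) (X Y : nat -> R).
Hypothesis (X_incr : forall k, X k < X k.+1) (Y_incr : forall k, Y k < Y k.+1).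

Lemma incr_leE (Z : nat -> R) : (forall k, Z k < Z k.+1) ->
  forall a b, (Z a <= Z b) = (a <= b)%N.
Proof.
move=> Z_incr a b; have Z_homo := homo_ltn lt_trans Z_incr.
case: (ltngtP a b) => [/Z_homo/ltW|/Z_homo|->] //; last exact: lexx.
by rewrite ltNge => /negbTE.
Qed.

Lemma incr_inj (Z : nat -> R) : (forall k, Z k < Z k.+1) -> injective Z.
Proof.
by move=> Z_incr a b ab; apply/eqP; rewrite eqn_leq -!(incr_leE Z_incr) ab lexx.
Qed.

Definition grid (p : nat * nat) : 'rV[R]_2 := vec2 (X p.1) (Y p.2).

Lemma grid_inj : injective grid.
Proof.
move=> [a b] [c d] /rowP h; have := h 1; have := h 0; rewrite !mxE /=.
by move=> /(incr_inj X_incr)-> /(incr_inj Y_incr)->.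
Qed.

(* The rectangle in column i and row j <= i of the grid is cut by its increasing
   diagonal; the boolean tells the upper triangle from the lower one. *)
Definition stair_cell : finType :=
  {c : 'I_n * 'I_n * bool | (c.1.2 <= c.1.1)%N}.

Implicit Types c : stair_cell.

Definition col c : nat := (val c).1.1.
Definition row c : nat := (val c).1.2.
Definition upper c : bool := (val c).2.

(** Corners are kept as grid indices, so that by [grid_inj] incidence of sides becomes arithmetic of
    natural numbers. *)
Definition node c (k : 'I_3) : nat * nat :=
  match val k, upper c with
  | 0, _ => (col c, row c)
  | 1, false => ((col c).+1, row c)
  | 1, true => ((col c).+1, (row c).+1)
  | _, false => ((col c).+1, (row c).+1)
  | _, true => (col c, (row c).+1)
  end%N.

Definition stair_corner c k := grid (node c k).

Lemma cell_exists i j b : (j <= i < n)%N ->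
  exists c, [/\ col c = i, row c = j & upper c = b].
Proof.
case/andP=> ji ni.
by exists (exist _ (Ordinal ni, Ordinal (leq_ltn_trans ji ni), b) ji).
Qed.

Lemma cell_eq c c' :
  col c = col c' -> row c = row c' -> upper c = upper c' -> c = c'.
Proof.
move=> h1 h2 h3; apply/val_inj; move: h1 h2 h3; rewrite /col /row /upper.
by case: (val c) (val c') => [[i j] b] [[i' j'] b'] /= /val_inj-> /val_inj-> ->.
Qed.

Lemma row_le_col c : (row c <= col c < n)%N.
Proof. by rewrite (valP c) /col ltn_ord. Qed.

Lemma ord3_cases (k : 'I_3) : [\/ k = 0, k = 1 | k = 1 + 1].
Proof.
by case: k => [[|[|[|//]]] ?]; [apply: Or31|apply: Or32|apply: Or33]; apply/val_inj.
Qed.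

Lemma ord3_add : 1 + 1 + 1 = 0 :> 'I_3.
Proof. exact/val_inj. Qed.

Definition ord3E := (add0r, ord3_add).

Lemma opposed_node e f : opposed stair_corner e f =
  (node e.1 e.2 == node f.1 (f.2 + 1)) && (node e.1 (e.2 + 1) == node f.1 f.2).
Proof. by rewrite /opposed /stair_corner !(inj_eq grid_inj). Qed.

Lemma stair_opposed_sym e f : opposed stair_corner e f = opposed stair_corner f e.
Proof. by rewrite /opposed andbC [in RHS]eq_sym [X in _ && X]eq_sym. Qed.

(** The cases are the bottom, the right end, and the treads and risers of the stairs. Across any
    other side [opp] is given the neighbouring triangle. *)
Lemma boundary_cases c k : boundary stair_corner (c, k) ->
  [\/ [/\ k = 0, upper c = false & row c = 0%N],
      [/\ k = 1, upper c = false & (col c).+1 = n],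
      [/\ k = 1, upper c = true & row c = col c]
    | [/\ k = 1 + 1, upper c = true & row c = col c]].
Proof.
move=> /existsP nb.
have [ji ni] := andP (row_le_col c).
have opp i j b l : (j <= i < n)%N ->
  (forall c', [/\ col c' = i, row c' = j & upper c' = b] ->
    opposed stair_corner (c, k) (c', l)) -> False.
  by move=> ij h; apply: nb; have [c' c'P] := cell_exists b ij; exists (c', l); apply: h.
case: (ord3_cases k) => kE; case cb: (upper c).
- exfalso; apply: (opp (col c) (row c) false (1 + 1)); first by rewrite ji ni.
  by move=> c' [h1 h2 h3]; rewrite opposed_node kE !ord3E /node /= cb h1 h2 h3 !eqxx.
- have [j0|j0] := posnP (row c); first by apply: Or41.
  exfalso; apply: (opp (col c) (row c).-1 true 1); first by lia.
  move=> c' [h1 h2 h3]; rewrite opposed_node kE !ord3E /node /= cb h1 h2 h3.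
  by rewrite prednK ?eqxx.
- have [ij|ij] := eqVneq (row c) (col c); first by apply: Or43.
  exfalso; apply: (opp (col c) (row c).+1 false 0); first by lia.
  by move=> c' [h1 h2 h3]; rewrite opposed_node kE !ord3E /node /= cb h1 h2 h3 !eqxx.
- have [ij|ij] := eqVneq (col c).+1 n; first by apply: Or42.
  exfalso; apply: (opp (col c).+1 (row c) true (1 + 1)); first by lia.
  by move=> c' [h1 h2 h3]; rewrite opposed_node kE !ord3E /node /= cb h1 h2 h3 !eqxx.
- have [ij|ij] := eqVneq (row c) (col c); first by apply: Or44.
  exfalso; apply: (opp (col c).-1 (row c) false 1); first by lia.
  move=> c' [h1 h2 h3]; rewrite opposed_node kE !ord3E /node /= cb h1 h2 h3.
  by rewrite prednK ?eqxx //; lia.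
- exfalso; apply: (opp (col c) (row c) true 0); first by rewrite ji ni.
  by move=> c' [h1 h2 h3]; rewrite opposed_node kE !ord3E /node /= cb h1 h2 h3 !eqxx.
Qed.

(** The four kinds of boundary side start at the nodes (i, 0), (n, j), (i+1, i+1) and (i, i+1) with
    i, j < n, which are all distinct. *)
Lemma stair_simple e f : boundary stair_corner e -> boundary stair_corner f ->
  stair_corner e.1 e.2 = stair_corner f.1 f.2 -> e = f.
Proof.
case: e f => [c k] [c' k'] /boundary_cases hc /boundary_cases hc' /grid_inj /=.
have := row_le_col c; have := row_le_col c'.
by case: hc => -[-> cb h]; case: hc' => -[-> cb' h'];
  rewrite /node /= ?cb ?cb' => b b' [h1 h2]; first
  [ congr pair; apply: cell_eq; rewrite ?cb ?cb' //; lia | exfalso; lia].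
Qed.

Lemma stair_axis e : boundary stair_corner e ->
  horizontal stair_corner e || vertical stair_corner e.
Proof.
case: e => c k /boundary_cases[] [-> cb _];
  by rewrite /horizontal /vertical /edge ?ord3E /stair_corner /node /= cb
    !mxE /= subrr eqxx ?orbT.
Qed.

Lemma stair_nonempty : (0 < #|stair_cell|)%N.
Proof.
have [c _] := @cell_exists 0 0 false n_gt0.
by apply/card_gt0P; exists c.
Qed.

(** Every triangle is joined to the lower triangle [o] at the origin by going down its column and
    then left along the bottom row. *)
Lemma stair_connected c c' :
  connect [rel x y | [exists k, [exists l, opposed stair_corner (x, k) (y, l)]]] c c'.
Proof.
set adj := [rel x y | _]; have adj_sym : symmetric adj.
  by move=> x y; apply/existsP/existsP => -[k /existsP[l kl]];
    exists l; apply/existsP; exists k; rewrite stair_opposed_sym.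
have step x k y l : opposed stair_corner (x, k) (y, l) -> connect adj x y.
  by move=> kl; apply/connect1/existsP; exists k; apply/existsP; exists l.
have diag x y : col x = col y -> row x = row y -> upper x -> ~~ upper y ->
    connect adj x y.
  move=> h1 h2 ux /negbTE uy; apply: (step _ 0 _ (1 + 1)).
  by rewrite opposed_node !ord3E /node /= ux uy h1 h2 !eqxx.
have [o [o1 o2 o3]] := @cell_exists 0 0 false n_gt0.
have bottom x : row x = 0%N -> ~~ upper x -> connect adj x o.
  move: {2}(col x) (erefl (col x)) => i; elim: i x => [|i IHi] x xi x0 ux.
    by rewrite (@cell_eq x o) ?connect0 ?x0 ?xi ?o3 ?(negbTE ux).
  have ni : (i.+1 < n)%N by have := row_le_col x; lia.
  have [y [y1 y2 y3]] := @cell_exists i.+1 0 true ni.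
  have [z [z1 z2 z3]] := @cell_exists i 0 false (ltnW ni).
  apply: (@connect_trans _ _ y).
    by rewrite sym_connect_sym // diag ?y1 ?y2 ?y3.
  apply: (@connect_trans _ _ z); last by rewrite IHi ?z3.
  apply: (step _ (1 + 1) _ 1).
  by rewrite opposed_node !ord3E /node /= y1 y2 y3 z1 z2 z3 !eqxx.
have lower x : ~~ upper x -> connect adj x o.
  move: {2}(row x) (erefl (row x)) => j; elim: j x => [|j IHj] x xj ux.
    exact: bottom.
  have ij : (j <= col x < n)%N by have := row_le_col x; lia.
  have [y [y1 y2 y3]] := cell_exists true ij.
  have [z [z1 z2 z3]] := cell_exists false ij.
  apply: (@connect_trans _ _ y).
    apply: (step _ 0 _ 1).
    by rewrite opposed_node !ord3E /node /= xj y1 y2 y3 (negbTE ux) !eqxx.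
  apply: (@connect_trans _ _ z); last by rewrite IHj ?z3.
  by rewrite diag ?y1 ?y2 ?y3 ?z1 ?z2 ?z3.
have origin x : connect adj x o.
  case ux: (upper x); last by rewrite lower ?ux.
  have [y [y1 y2 y3]] := cell_exists false (row_le_col x).
  by apply: connect_trans (diag x y _ _ _ _) (lower y _); rewrite ?y1 ?y2 ?y3.
by apply: connect_trans (origin c) _; rewrite sym_connect_sym.
Qed.

Lemma det2_edge c k x : det2 (edge stair_corner c k) (x - stair_corner c k) =
  let: (i, j) := (col c, row c) in
  match val k, upper c with
  | 0%N, false => (X i.+1 - X i) * (x 0 1 - Y j)
  | 1%N, false => (Y j.+1 - Y j) * (X i.+1 - x 0 0)
  | _, false => (X i.+1 - X i) * (Y j - x 0 1) + (Y j.+1 - Y j) * (x 0 0 - X i)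
  | 0%N, true => (X i.+1 - X i) * (x 0 1 - Y j) - (Y j.+1 - Y j) * (x 0 0 - X i)
  | 1%N, true => (X i.+1 - X i) * (Y j.+1 - x 0 1)
  | _, true => (Y j.+1 - Y j) * (x 0 0 - X i)
  end.
Proof.
rewrite /edge /stair_corner; case: (ord3_cases k) => ->;
  by rewrite ?ord3E /node /=; case: (upper c); rewrite /det2 !mxE /=; ring.
Qed.

Lemma stair_ccw c : 0 < det2 (edge stair_corner c 0) (edge stair_corner c 1).
Proof.
rewrite /edge /stair_corner !ord3E /node /=.
have := X_incr (col c); have := Y_incr (row c); rewrite -![_ < _ _.+1]subr_gt0.
move=> y0 x0; have := mulr_gt0 x0 y0.
by case: (upper c); rewrite /det2 !mxE /=; congr (_ < _); ring.
Qed.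

Lemma in_open_cell c x : in_open stair_corner c x ->
  let: (i, j) := (col c, row c) in
  [/\ X i < x 0 0 < X i.+1, Y j < x 0 1 < Y j.+1
    & let d := (Y j.+1 - Y j) * (x 0 0 - X i) - (X i.+1 - X i) * (x 0 1 - Y j) in
      if upper c then d < 0 else 0 < d].
Proof.
move=> h; have := h 0; have := h 1; have := h (1 + 1); rewrite !det2_edge /=.
have := X_incr (col c); have := Y_incr (row c); rewrite -![_ < _ _.+1]subr_gt0.
move: (X (col c)) (X _.+1) (Y (row c)) (Y _.+1) (x 0 0) (x 0 1) => X0 X1 Y0 Y1 s t.
(* The two axis-parallel sides give two of the four bounds; combined with the inequality of the
   diagonal they give the other two. *)
by case: (upper c) => /= h1 h2 h3 h4 h5; split; try (apply/andP; split); nra.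
Qed.

Lemma in_closed_cell c x : in_closed stair_corner c x ->
  let: (i, j) := (col c, row c) in
  [/\ X i <= x 0 0 <= X i.+1, Y j <= x 0 1 <= Y j.+1
    & let d := (Y j.+1 - Y j) * (x 0 0 - X i) - (X i.+1 - X i) * (x 0 1 - Y j) in
      if upper c then d <= 0 else 0 <= d].
Proof.
move=> h; have := h 0; have := h 1; have := h (1 + 1); rewrite !det2_edge /=.
have := X_incr (col c); have := Y_incr (row c); rewrite -![_ < _ _.+1]subr_gt0.
move: (X (col c)) (X _.+1) (Y (row c)) (Y _.+1) (x 0 0) (x 0 1) => X0 X1 Y0 Y1 s t.
by case: (upper c) => /= h1 h2 h3 h4 h5; split; try (apply/andP; split); nra.
Qed.

Lemma incr_between (Z : nat -> R) (z : R) a b : (forall k, Z k < Z k.+1) ->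
  Z a < z < Z a.+1 -> Z b < z < Z b.+1 -> a = b.
Proof.
move=> Z_incr /andP[a1 a2] /andP[b1 b2].
have := lt_trans a1 b2; have := lt_trans b1 a2.
by rewrite !ltNge !(incr_leE Z_incr); lia.
Qed.

Lemma stair_disjoint c c' x :
  in_open stair_corner c x -> in_open stair_corner c' x -> c = c'.
Proof.
move=> /in_open_cell[xi yj d] /in_open_cell[xi' yj' d'].
have ii' := incr_between X_incr xi xi'; have jj' := incr_between Y_incr yj yj'.
apply: cell_eq => //; move: d d'; rewrite -ii' -jj'.
by case: (upper c); case: (upper c') => //= /lt_trans h /h; rewrite ltxx.
Qed.

(** A grid node in a closed rectangle of the grid is one of its four corners, and the diagonal
    inequality excludes the corner that the triangle lacks. *)
Lemma stair_edge_to_edge c c' k :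
  in_closed stair_corner c (stair_corner c' k) ->
  exists l, stair_corner c' k = stair_corner c l.
Proof.
rewrite /stair_corner; move: (node c' k) => [p q] /in_closed_cell.
rewrite !mxE /= !(incr_leE X_incr) !(incr_leE Y_incr) => -[ip jq].
have := X_incr (col c); have := Y_incr (row c); rewrite -![_ < _ _.+1]subr_gt0.
move=> y0 x0.
have [->|p1] : p = col c \/ p = (col c).+1 by lia.
  rewrite subrr mulr0 sub0r.
  have [->|q1] : q = row c \/ q = (row c).+1 by lia.
    by exists 0.
  rewrite q1; case uc: (upper c).
    by exists (1 + 1); rewrite /node /= uc.
  by rewrite oppr_ge0 leNgt mulr_gt0.
rewrite p1; have [->|->] : q = row c \/ q = (row c).+1 by lia.
  rewrite subrr mulr0 subr0; case uc: (upper c).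
    by rewrite leNgt mulr_gt0.
  by exists 1; rewrite /node /= uc.
by case uc: (upper c) => _; [exists 1 | exists (1 + 1)]; rewrite /node /= uc.
Qed.

Definition staircase_table : right_angled_table R :=
  RightAngledTable stair_nonempty stair_ccw stair_disjoint stair_edge_to_edge
    stair_connected stair_simple stair_axis.

End Table.

(** * The SAF invariant of a staircase *)

Section Saf.
Variable R : realType.

Section WedgeTheory.
Variable V : lmodType R.
Implicit Types u v w : V.

Lemma wedge0l v : wedge 0 v = 0.
Proof. by apply: (addrI (wedge 0 v)); rewrite -wedgeDl !addr0. Qed.

Lemma wedge0r v : wedge v 0 = 0.
Proof. by apply: (addrI (wedge v 0)); rewrite -wedgeDr !addr0. Qed.

Lemma wedgeNl u v : wedge (- u) v = - wedge u v.
Proof. by apply/eqP; rewrite -addr_eq0 -wedgeDl addNr wedge0l. Qed.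

Lemma wedgeNr u v : wedge u (- v) = - wedge u v.
Proof. by apply/eqP; rewrite -addr_eq0 -wedgeDr addNr wedge0r. Qed.

Lemma wedgeC u v : wedge u v = - wedge v u.
Proof.
have /eqP := wedgevv (u + v).
by rewrite wedgeDl !wedgeDr !wedgevv add0r addr0 addr_eq0 => /eqP.
Qed.

(* The reflections in the axes kill the components A /\ C and B /\ D. *)
Lemma wedge_reflect (A B C D : V) :
  wedge (A + B) (C + D) - wedge (A - B) (C - D) = (wedge A D + wedge B C) *+ 2.
Proof.
pose p := wedge A C + wedge B D; pose q := wedge A D + wedge B C.
have -> : wedge (A + B) (C + D) = p + q.
  by rewrite wedgeDl !wedgeDr [wedge B C + _]addrC addrACA.
have -> : wedge (A - B) (C - D) = p - q.
  rewrite wedgeDl !wedgeDr !wedgeNl !wedgeNr opprK.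
  by rewrite [- wedge B C + _]addrC addrACA -opprD.
by rewrite opprB addrC addrA subrK mulr2n.
Qed.

End WedgeTheory.

Lemma wedge_map0 (V W : lmodType R) (f : V -> W) : linear f -> wedge_map f 0 = 0.
Proof.
move=> fl; have /eqP := wedge_mapD 0 0 fl.
by rewrite addr0 -subr_eq0 opprD addNKr oppr_eq0 => /eqP.
Qed.

Lemma wedge_map_sum (V W : lmodType R) (f : V -> W) I (r : seq I) (F G : I -> V) :
  linear f -> wedge_map f (\sum_(i <- r) wedge (F i) (G i)) =
              \sum_(i <- r) wedge (f (F i)) (f (G i)).
Proof.
move=> fl; elim/big_rec2: _ => [|i x y _ <-]; first exact: wedge_map0.
by rewrite wedge_mapD // wedge_map_wedge.
Qed.

Lemma SAF_sum (S : translation_surface R) v :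
  SAF S v = \sum_(t : face S) wedge (proj v (side t 0)) (proj v (side t 1)).
Proof. exact/wedge_map_sum/proj_linear. Qed.

(** If the projection of u is b u_x + a u_y, this is the part of the wedge of two projections that
    pairs a horizontal with a vertical component. *)
Definition mixed_wedge (a b : R) (u w : 'rV[R]_2) : wedge_square R^o :=
  wedge (b * u 0 0 : R^o) (a * w 0 1 : R^o) +
  wedge (a * u 0 1 : R^o) (b * w 0 0 : R^o).

(** The two orientation-preserving copies of a triangle give equal wedges, and so do the two
    reversing ones. This doubles the identity [wedge_reflect], whence the 4. *)
Lemma SAF_unfolding (P : right_angled_table R) v :
  SAF (unfolding P) v = (\sum_(c : cell P)
    mixed_wedge (v 0 0 / norm2 v) (- v 0 1 / norm2 v)
      (edge (@corner R P) c 0) (edge (@corner R P) c 1)) *+ 4.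
Proof.
rewrite SAF_sum -sumrMnl.
pose F (t : face (unfolding P)) := wedge (proj v (side t 0)) (proj v (side t 1)).
transitivity (\sum_(c : cell P) \sum_(r : bool * bool) F (c, r)).
  by rewrite pair_bigA; apply: eq_bigr => -[].
apply: eq_bigr => c _.
rewrite -(pair_bigA _ (fun r1 r2 => F (c, (r1, r2)))) !big_bool /= /F /= /unfold_side /=.
set u := edge _ c 0; set w := edge _ c 1.
have -> : edge (@corner R P) c (- 0) = u by rewrite oppr0.
(* In a reversing copy the sides 0 and 1 come from the sides 0 and -1 of the cell. *)
have -> : edge (@corner R P) c (-1) = - u - w.
  have := edge_sum c; rewrite !big_ord_recl big_ord0 addr0.
  rewrite (_ : lift ord0 (lift ord0 ord0) = -1 :> 'I_3); last exact/val_inj.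
  rewrite (_ : lift ord0 ord0 = 1 :> 'I_3); last exact/val_inj.
  by rewrite -/u -/w addrA => /eqP; rewrite addrC addr_eq0 opprD => /eqP.
rewrite /mixed_wedge; set a := v 0 0 / _; set b := - v 0 1 / _.
pose A : R^o := b * u 0 0; pose B : R^o := a * u 0 1.
pose C : R^o := b * w 0 0; pose D : R^o := a * w 0 1.
rewrite -/A -/B -/C -/D.
have -> : proj v ((-1) ^+ 0 *: reflect2 (true, true) u) = - (A + B).
  by rewrite /proj /det2 /A /B /a /b !mxE /=; ring.
have -> : proj v ((-1) ^+ 0 *: reflect2 (true, true) w) = - (C + D).
  by rewrite /proj /det2 /C /D /a /b !mxE /=; ring.
have -> : proj v ((-1) ^+ 0 *: reflect2 (false, false) u) = A + B.
  by rewrite /proj /det2 /A /B /a /b !mxE /=; ring.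
have -> : proj v ((-1) ^+ 0 *: reflect2 (false, false) w) = C + D.
  by rewrite /proj /det2 /C /D /a /b !mxE /=; ring.
have -> : proj v ((-1) ^+ 1 *: reflect2 (true, false) u) = A - B.
  by rewrite /proj /det2 /A /B /a /b !mxE /=; ring.
have -> : proj v ((-1) ^+ 1 *: reflect2 (false, true) u) = - (A - B).
  by rewrite /proj /det2 /A /B /a /b !mxE /=; ring.
have -> : proj v ((-1) ^+ 1 *: reflect2 (true, false) (- u - w)) = - (A - B) - (C - D).
  by rewrite /proj /det2 /A /B /C /D /a /b !mxE /=; ring.
have -> : proj v ((-1) ^+ 1 *: reflect2 (false, true) (- u - w)) = (A - B) + (C - D).
  by rewrite /proj /det2 /A /B /C /D /a /b !mxE /=; ring.
have -> : wedge (A - B) (- (A - B) - (C - D)) = - wedge (A - B) (C - D).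
  by rewrite wedgeDr !wedgeNr wedgevv oppr0 add0r.
have -> : wedge (- (A - B)) (A - B + (C - D)) = - wedge (A - B) (C - D).
  by rewrite wedgeNl wedgeDr wedgevv add0r.
rewrite wedgeNl wedgeNr opprK [- _ + wedge _ _]addrC -mulr2n wedge_reflect.
by rewrite -mulrnA.
Qed.

Lemma sum_stair_cell n (V : zmodType) (F : nat -> nat -> bool -> V) :
  \sum_(c : stair_cell n) F (col c) (row c) (upper c) =
  \sum_(i < n) \sum_(j < n | (j <= i)%N) (F i j true + F i j false).
Proof.
rewrite -[LHS](big_sub [pred c : 'I_n * 'I_n * bool | (c.1.2 <= c.1.1)%N]
  (fun c => F c.1.1 c.1.2 c.2)).
rewrite pair_big_dep /=.
under [RHS]eq_bigr => p _ do rewrite -(big_bool _ (fun b => F p.1 p.2 b)).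
rewrite pair_big_dep /=.
by apply: eq_bigl => x; rewrite inE andbT.
Qed.

End Saf.

Section StaircaseSaf.
Variables (R : realType) (K : fieldExtType rat) (iota : {rmorphism K -> R}).
Variables (n : nat) (n_gt0 : (0 < n)%N) (w h : nat -> K).
Hypothesis (w_gt0 : forall i, 0 < iota (w i)) (h_gt0 : forall j, 0 < iota (h j)).

Let X k := iota (\sum_(i < k) w i).
Let Y k := iota (\sum_(j < k) h j).

Fact X_incr k : X k < X k.+1.
Proof. by rewrite /X big_ord_recr rmorphD ltrDl. Qed.

Fact Y_incr k : Y k < Y k.+1.
Proof. by rewrite /Y big_ord_recr rmorphD ltrDl. Qed.

Definition number_field_table := staircase_table n_gt0 X_incr Y_incr.

(** Both triangles of a rectangle contribute the wedge of its width with its height, which turns the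
    factor 4 into 8. *)
Lemma SAF_staircase v :
  SAF (unfolding number_field_table) v =
  teval (fun a b => wedge (- v 0 1 / norm2 v * iota a : R^o)
                          (v 0 0 / norm2 v * iota b : R^o))
    (staircase w h n) *+ 8.
Proof.
rewrite SAF_unfolding; set a := v 0 0 / _; set b := - v 0 1 / _.
rewrite (eq_bigr (fun c : stair_cell n =>
  wedge (b * iota (w (col c)) : R^o) (a * iota (h (row c)) : R^o))); last first.
  move=> c _; rewrite /mixed_wedge /edge /= /stair_corner ?ord3E /node /=.
  have Xw k : X k.+1 - X k = iota (w k) by rewrite /X big_ord_recr rmorphD addrC addKr.
  have Yh k : Y k.+1 - Y k = iota (h k) by rewrite /Y big_ord_recr rmorphD addrC addKr.
  case: (upper c); rewrite !mxE /= ?subrr ?Xw ?Yh ?mulr0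
    ?wedge0l ?wedge0r ?add0r ?addr0 //.
  by rewrite -opprB Xw mulrN wedgeNr [RHS]wedgeC.
rewrite (@sum_stair_cell n _ (fun i j _ =>
  wedge (b * iota (w i) : R^o) (a * iota (h j) : R^o))) teval_staircase.
under eq_bigr => i _ do under eq_bigr => j _ do rewrite -mulr2n.
under eq_bigr => i _ do rewrite sumrMnl.
by rewrite sumrMnl -mulrnA.
Qed.

End StaircaseSaf.

(** * Forms on the exterior square *)

Section Functional.
Variable R : realType.

Definition rat_closed (U : set R) : Prop :=
  forall (q : rat) x y, U x -> U y -> U (ratr q * x + y).

(** Zorn gives a Q-subspace [H] containing [U] and maximal among those that avoid [l]. Every real is
    congruent modulo [H] to exactly one rational multiple of [l], and [p] is that coefficient. *)
Lemma rational_functional (U : set R) (l : R) :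
  U 0 -> rat_closed U -> ~ U l ->
  exists p : R -> rat, [/\ forall q x y, p (ratr q * x + y) = q * p x + p y,
    forall x, U x -> p x = 0 & p l = 1].
Proof.
(* The condition is put on the union with [U] because the empty chain, whose union is empty, must
   satisfy it too. *)
move=> U0 Ucl Ul; pose P (A : set R) := rat_closed (A `|` U) /\ ~ (A `|` U) l.
have [F FP Ftot|A [[Acl Al] Amax]] := @Zorn_bigcup R P.
  have pick2 x y : (\bigcup_(X in F) X `|` U) x -> (\bigcup_(X in F) X `|` U) y ->
      (U x /\ U y) \/ exists2 X, F X & (X `|` U) x /\ (X `|` U) y.
    move=> [[X FX Xx]|Ux] [[Z FZ Zy]|Uy]; [|right|right|by left].
    - right; have [XZ|ZX] := Ftot X Z FX FZ.
        by exists Z => //; split; left => //; apply: XZ.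
      by exists X => //; split; left => //; apply: ZX.
    - by exists X => //; split; [left|right].
    - by exists Z => //; split; [right|left].
  have sub X x : F X -> (X `|` U) x -> (\bigcup_(X in F) X `|` U) x.
    by move=> FX [Xx|Ux]; [left; exists X|right].
  split=> [q x y /pick2 h /h[[Ux Uy]|[X FX [Xx Xy]]]|[[X FX Xl]|//]].
  - by right; apply: Ucl.
  - by apply: (sub X) => //; apply: (FP X FX).1.
  - by apply: (FP X FX).2; left.
set H := A `|` U in Acl Al; have H0 : H 0 by right.
have HZ q x : H x -> H (ratr q * x) by move=> Hx; rewrite -[_ * x]addr0; apply: Acl.
have HD x y : H x -> H y -> H (x + y).
  by move=> Hx Hy; rewrite -[x]mul1r -(rmorph1 (@ratr R)); apply: Acl.
have /choice[p pH] x : exists q : rat, H (x - ratr q * l).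
  apply: contrapT => nq.
  (* The span of [H] and [x]. By maximality it contains [l], with a nonzero coefficient at [x];
     dividing by it expresses [x] through [l] modulo [H]. *)
  pose B := [set z | exists q : rat, H (z - ratr q * x)].
  have HB z : H z -> B z by move=> Hz; exists 0; rewrite rmorph0 mul0r subr0.
  have BU : B `|` U = B.
    by apply/seteqP; split=> z; [case=> // Uz; apply: HB; right|left].
  apply: (Amax B); split; first by move=> z Az; apply: HB; left.
  - move=> BA; apply: nq; exists 0; rewrite rmorph0 mul0r subr0.
    by left; apply: BA; exists 1; rewrite rmorph1 mul1r subrr.
  - rewrite /P BU => q y z [r Hr] [s Hs]; exists (q * r + s).
    rewrite (_ : _ - _ = ratr q * (y - ratr r * x) + (z - ratr s * x)); first exact: Acl.
    by rewrite rmorphD rmorphM; ring.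
  rewrite BU => -[r Hr]; have [r0|r0] := eqVneq r 0.
    by apply: Al; move: Hr; rewrite r0 rmorph0 mul0r subr0.
  apply: nq; exists r^-1.
  rewrite (_ : _ - _ = ratr (- r^-1) * (l - ratr r * x)); first exact: HZ.
  by rewrite rmorphN fmorphV; field; rewrite fmorph_eq0.
have puniq x q : H (x - ratr q * l) -> p x = q.
  move=> Hq; apply/eqP/negPn/negP => pq; apply: Al.
  have pq0 : ratr (p x - q) != 0 :> R by rewrite fmorph_eq0 subr_eq0.
  rewrite (_ : l = ratr (p x - q)^-1 *
    (ratr (- 1) * (x - ratr (p x) * l) + (x - ratr q * l))).
    by apply: (HZ); apply: HD => //; apply: HZ.
  rewrite fmorphV rmorphN rmorph1; move: pq0; rewrite rmorphB => pq0; field.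
  by [].
exists p; split.
- move=> q x y; apply: puniq.
  rewrite (_ : _ - _ = ratr q * (x - ratr (p x) * l) + (y - ratr (p y) * l)).
    by apply: HD => //; apply: HZ.
  by rewrite rmorphD rmorphM; ring.
- by move=> x Ux; apply: puniq; rewrite rmorph0 mul0r subr0; right.
- by apply: puniq; rewrite rmorph1 mul1r subrr.
Qed.

Section Form.
Variables (V : lmodType R) (w : V -> V -> R).
Hypotheses (wDl : forall u u' v, w (u + u') v = w u v + w u' v)
  (wDr : forall u v v', w u (v + v') = w u v + w u v')
  (wZl : forall (c : rat) u v, w (ratr c *: u) v = ratr c * w u v)
  (wZr : forall (c : rat) u v, w u (ratr c *: v) = ratr c * w u v)
  (wvv : forall u, w u u = 0).

Definition formal_form (x : formal V) : R :=
  \sum_(k <- msupp x) ratr x@_k * w k.1 k.2.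

Lemma formal_formEw (d : {fset (V * V)%type}) (x : formal V) :
  (msupp x `<=` d)%fset ->
  formal_form x = \sum_(k <- d) ratr x@_k * w k.1 k.2.
Proof.
move=> sxd; rewrite /formal_form (big_fset_incl _ sxd) // => k _ kx.
by rewrite mcoeff_outdom // rmorph0 mul0r.
Qed.

Lemma formal_formD x y : formal_form (x + y) = formal_form x + formal_form y.
Proof.
pose d := (msupp x `|` msupp y)%fset.
rewrite !(@formal_formEw d) ?fsubsetUl ?fsubsetUr ?msuppD_le // -big_split /=.
by apply: eq_bigr => k _; rewrite mcoeffD rmorphD mulrDl.
Qed.

Lemma formal_formZ (c : rat) x : formal_form (c *: x) = ratr c * formal_form x.
Proof.
rewrite (@formal_formEw (msupp x)) ?msuppZ_le // mulr_sumr.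
by apply: eq_bigr => k _; rewrite mcoeffZ rmorphM mulrA.
Qed.

Lemma formal_form_pair u v : formal_form (fpair u v) = w u v.
Proof.
have sE : msupp (fpair u v) = [fset (u, v)]%fset by rewrite /fpair msuppU oner_eq0.
by rewrite /formal_form sE big_seq_fset1 /fpair mcoeffUU rmorph1 mul1r.
Qed.

Lemma formal_formB x y : formal_form (x - y) = formal_form x - formal_form y.
Proof. by rewrite -scaleN1r formal_formD formal_formZ rmorphN rmorph1 mulN1r. Qed.

Lemma formal_form_null x : wedge_null x -> formal_form x = 0.
Proof.
elim=> [u u' v|u v v'|c u v|c u v|u||y z _ IHy _ IHz|c y _ IHy];
  rewrite ?formal_formB ?formal_formD ?formal_formZ ?formal_form_pair.
- by rewrite wDl; ring.
- by rewrite wDr; ring.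
- by rewrite wZl subrr.
- by rewrite wZr subrr.
- exact: wvv.
- by rewrite -(scale0r (0 : formal V)) formal_formZ rmorph0 mul0r.
- by rewrite IHy IHz addr0.
- by rewrite IHy mulr0.
Qed.

(** A value on a representative, independent of the choice by [wedge_formE]; such forms certify that
    a wedge is nonzero. *)
Definition wedge_form (x : wedge_square V) : R := formal_form (repr x).

Lemma wedge_formE x : wedge_form (\pi_(wedge_square V) x) = formal_form x.
Proof.
apply/eqP; rewrite -subr_eq0 -formal_formB; apply/eqP/formal_form_null.
by apply/asboolP/wedge_eqP; rewrite reprK.
Qed.

Lemma wedge_form_zmod : zmod_morphism wedge_form.
Proof.
by move=> x y; rewrite -[x]reprK -[y]reprK -raddfB !wedge_formE formal_formB.
Qed.
HB.instance Definition _ :=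
  GRing.isZmodMorphism.Build (wedge_square V) R wedge_form wedge_form_zmod.

Lemma wedge_form_wedge u v : wedge_form (wedge u v) = w u v.
Proof. by rewrite wedge_formE formal_form_pair. Qed.

Lemma wedge_form_sum I (r : seq I) (F G : I -> V) n :
  wedge_form ((\sum_(i <- r) wedge (F i) (G i)) *+ n) =
  (\sum_(i <- r) w (F i) (G i)) *+ n.
Proof.
rewrite raddfMn raddf_sum; congr (_ *+ _).
by apply: eq_bigr => i _; apply: wedge_form_wedge.
Qed.

End Form.

End Functional.

(** * Changes of coordinates *)

Section Transform.
Variables (R : realType).

Lemma norm2_eq0 (v : 'rV[R]_2) : (norm2 v == 0) = (v == 0).
Proof.
rewrite /norm2 /dot sqrtr_eq0 -!expr2.
apply/idP/eqP => [h|->]; last by rewrite !mxE expr0n addr0.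
have := sqr_ge0 (v 0 0); have := sqr_ge0 (v 0 1) => h1 h0.
by apply: vec2P; rewrite mxE; apply/eqP; rewrite -sqrf_eq0; apply/eqP; lra.
Qed.

Lemma wedge_sum_scale (I : finType) (F G : I -> R^o) (c : R) :
  \sum_i wedge (F i) (G i) = 0 ->
  \sum_i wedge (c * F i : R^o) (c * G i : R^o) = 0.
Proof.
have mc : linear (fun x : R^o => c * x : R^o).
  by move=> a x y; rewrite /GRing.scale /=; ring.
move=> S0; have := wedge_map_sum (index_enum I) F G mc.
by rewrite S0 wedge_map0.
Qed.

Lemma wedge_sum_scale_eq0 (I : finType) (F G : I -> R^o) (c : R) : c != 0 ->
  \sum_i wedge (c * F i : R^o) (c * G i : R^o) = 0 <->
  \sum_i wedge (F i) (G i) = 0.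
Proof.
move=> c0; split; last exact: wedge_sum_scale.
move=> /(@wedge_sum_scale _ _ _ c^-1) S0; rewrite -[RHS]S0.
by apply: eq_bigr => i _; rewrite !mulKf.
Qed.

Lemma SAF_transform (S : translation_surface R) (g : 'M[R]_2) (gU : g \in unitmx) v :
  SAF (transform S gU) v = 0 <->
    \sum_(t : face S) wedge (proj v (side t 0 *m g)) (proj v (side t 1 *m g)) = 0.
Proof.
rewrite SAF_sum /= /transform_side /flip.
have pZ (c : R) u : proj v (c *: u) = c * proj v u.
  by rewrite /proj /det2 !mxE; ring.
have pD u w : proj v (u + w) = proj v u + proj v w.
  by rewrite /proj /det2 !mxE; ring.
case: (\det g < 0); last first.
  by under eq_bigr => t _ do rewrite expr0 !scale1r.
suff -> : \sum_(t : face S) wedge (proj v ((-1) ^+ true *: (side t (- 0) *m g)))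
      (proj v ((-1) ^+ true *: (side t (-1) *m g))) =
    - \sum_(t : face S) wedge (proj v (side t 0 *m g)) (proj v (side t 1 *m g)).
  by split=> /eqP; rewrite ?oppr_eq0 => /eqP // ->; rewrite oppr0.
rewrite -sumrN; apply: eq_bigr => t _.
have -> : side t (-1) = - side t 0 - side t 1.
  have := side_sum t; rewrite !big_ord_recl big_ord0 addr0.
  rewrite (_ : lift ord0 (lift ord0 ord0) = -1 :> 'I_3); last exact/val_inj.
  rewrite (_ : lift ord0 ord0 = 1 :> 'I_3); last exact/val_inj.
  by rewrite addrA => /eqP; rewrite addrC addr_eq0 opprD => /eqP.
have -> : (-1) ^+ true *: ((- side t 0 - side t 1) *m g) = side t 0 *m g + side t 1 *m g.
  by rewrite scaleN1r -opprD mulNmx opprK mulmxDl.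
have -> : (-1) ^+ true *: (side t (- 0) *m g) = - (side t 0 *m g).
  by rewrite scaleN1r oppr0.
rewrite pD -[- (_ *m _)]scaleN1r pZ mulN1r wedgeNl wedgeDr wedgevv.
by rewrite add0r.
Qed.

(** The projection along [v], taken after [g], has the line of [v *m invmx g] as its kernel, so it
    is a nonzero multiple of the projection along that line. *)
Lemma alg_periodic_transform (S : translation_surface R) (g : 'M[R]_2)
    (gU : g \in unitmx) v :
  alg_periodic (transform S gU) v <-> alg_periodic S (v *m invmx g).
Proof.
set v' := v *m invmx g; have vE : v = v' *m g by rewrite mulmxKV.
have v0 : (v == 0) = (v' == 0).
  by apply/eqP/eqP => [v0|v0]; rewrite ?vE ?v0 ?mul0mx // /v' v0 mul0mx.
rewrite /alg_periodic -v0; have [|nv] := eqVneq v 0; first by split=> -[].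
have g0 : \det g != 0 by rewrite -unitfE -unitmxE.
pose c := \det g * norm2 v' / norm2 v.
have c0 : c != 0 by rewrite !mulf_neq0 ?invr_eq0 ?norm2_eq0 -?v0.
have projE u : proj v (u *m g) = c * proj v' u.
  rewrite /proj /c {1}vE det2_mul; field.
  by rewrite !norm2_eq0 -v0 nv.
suff key : SAF (transform S gU) v = 0 <-> SAF S v' = 0.
  case: key => k1 k2.
  by split=> -[h0 h]; [exact: (conj h0 (k1 h)) | exact: (conj h0 (k2 h))].
apply: (iff_trans (SAF_transform S gU v)); rewrite SAF_sum.
rewrite (eq_bigr (fun t => wedge (c * proj v' (side t 0) : R^o)
                                 (c * proj v' (side t 1) : R^o))).
  exact: wedge_sum_scale_eq0.
by move=> t _; rewrite !projE.
Qed.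

End Transform.

(** * Directions defined over the number field *)

Section Directions.
Variables (R : realType) (K : fieldExtType rat) (iota : {rmorphism K -> R}).

(** The slope is cross-multiplied to include the vertical direction; the zero vector satisfies this
    as well. *)
Definition number_direction (v : 'rV[R]_2) : Prop :=
  exists a b : K, (a != 0) || (b != 0) /\ v 0 0 * iota b = v 0 1 * iota a.

Lemma number_directionP v : number_direction v ->
  exists (c : R) (a b : K), v = c *: vec2 (iota a) (iota b).
Proof.
case=> a [b [/orP[a0|b0] e]].
  exists (v 0 0 / iota a), a, b; apply: vec2P; rewrite !mxE /=.
    by field; rewrite fmorph_eq0.
  by rewrite mulrAC e; field; rewrite fmorph_eq0.
exists (v 0 1 / iota b), a, b; apply: vec2P; rewrite !mxE /=.
  by rewrite mulrAC -e; field; rewrite fmorph_eq0.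
by field; rewrite fmorph_eq0.
Qed.

(* Three K-rational directions determine the coordinates up to a real factor and
   a matrix over K. *)
Lemma number_direction_slopes (r s : 'rV[R]_2) : det2 r s != 0 ->
  number_direction r -> number_direction s -> number_direction (r + s) ->
  forall l, number_direction (r + l *: s) <-> range iota l.
Proof.
move=> + /number_directionP[x [a0 [b0 rE]]] /number_directionP[y [a1 [b1 sE]]].
rewrite rE sE => d0 [a2 [b2 [ab2 e2]]] l.
have {d0} [x0 y0 d0] : [/\ x != 0, y != 0 & a0 * b1 - b0 * a1 != 0].
  move: d0; rewrite /det2 !mxE /= => d0; split; apply: contra_neq d0 => h.
  - by rewrite h; ring.
  - by rewrite h; ring.
  - transitivity (x * y * iota (a0 * b1 - b0 * a1)); last by rewrite h rmorph0 mulr0.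
    by rewrite rmorphB !rmorphM /=; ring.
have indep a b : (a != 0) || (b != 0) -> a1 * b - b1 * a = 0 ->
    a0 * b - b0 * a = 0 -> False.
  move=> ab h1 h0; have: (a0 * b1 - b0 * a1) * a = 0 /\ (a0 * b1 - b0 * a1) * b = 0.
    split.
      transitivity (a1 * (a0 * b - b0 * a) - a0 * (a1 * b - b1 * a)); first by ring.
      by rewrite h0 h1; ring.
    transitivity (b1 * (a0 * b - b0 * a) - b0 * (a1 * b - b1 * a)); first by ring.
    by rewrite h0 h1; ring.
  case=> /eqP + /eqP; rewrite !mulf_eq0 (negPf d0) /= => ha hb.
  by move: ab; rewrite ha hb.
have {e2} e2 : x * iota (a0 * b2 - b0 * a2) = - y * iota (a1 * b2 - b1 * a2).
  by move: e2; rewrite !mxE /= !rmorphB !rmorphM /=; lra.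
set D0 := a0 * b2 - b0 * a2 in e2; set D1 := a1 * b2 - b1 * a2 in e2.
have D00 : D0 != 0.
  apply/eqP => h0; apply: (indep _ _ ab2); rewrite -/D0 -/D1 //.
  apply/eqP; move/eqP: e2; rewrite h0 rmorph0 mulr0 eq_sym mulf_eq0 oppr_eq0.
  by rewrite (negPf y0) fmorph_eq0.
have D10 : D1 != 0.
  apply: contra_neq D00 => h1; move/eqP: e2.
  by rewrite h1 rmorph0 mulr0 mulf_eq0 (negPf x0) fmorph_eq0 => /eqP.
(* That [r + s] also has a direction over K forces the ratio y / x of the real factors into K; [k]
   is this ratio. *)
pose k := - D0 / D1.
have k0 : k != 0 by rewrite mulf_neq0 ?oppr_eq0 ?invr_eq0.
have yE : y = x * iota k.
  rewrite /k fmorph_div rmorphN; apply: (mulIf (x := iota D1)).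
    by rewrite fmorph_eq0.
  by rewrite mulrA mulfVK ?fmorph_eq0 // mulrN e2 mulNr opprK.
rewrite {}yE; split.
  case=> a [b [ab]]; rewrite !mxE /= => e.
  have E10 : a1 * b - b1 * a != 0.
    apply/eqP => h1; apply: (indep _ _ ab h1); apply: (fmorph_inj iota); rewrite rmorph0.
    apply: (mulfI x0); rewrite mulr0.
    transitivity (- (x * iota k * l * iota (a1 * b - b1 * a))); last first.
      by rewrite h1 rmorph0; ring.
    by move: e; rewrite !rmorphB !rmorphM /=; lra.
  have kE10 := mulf_neq0 k0 E10.
  exists (- (a0 * b - b0 * a) / (k * (a1 * b - b1 * a))) => //.
  rewrite fmorph_div rmorphN; apply: (mulIf (x := iota (k * (a1 * b - b1 * a)))).
    by rewrite fmorph_eq0.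
  rewrite mulfVK ?fmorph_eq0 //; apply: (mulfI x0).
  by move: e; rewrite !(rmorphM, rmorphB) /=; lra.
case=> m _ <-; exists (a0 + m * k * a1), (b0 + m * k * b1); split.
  rewrite -negb_and; apply: contra d0 => /andP[/eqP ha /eqP hb].
  rewrite (_ : _ - _ = (a0 + m * k * a1) * b1 - (b0 + m * k * b1) * a1); last by ring.
  by rewrite ha hb !mul0r subrr.
by rewrite !mxE /= !(rmorphM, rmorphD) /=; ring.
Qed.

End Directions.

(** * Periodic directions of a surface with a symmetric tensor *)

Section PeriodicDirections.
Variables (R : realType) (K : fieldExtType rat) (iota : {rmorphism K -> R}).

Lemma balanced_wedge (b a : R) :
  balanced (fun x y : K => wedge (b * iota x : R^o) (a * iota y : R^o)).
Proof.
split=> [x x' y|x y y'|q x y].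
- by rewrite rmorphD mulrDr wedgeDl.
- by rewrite rmorphD mulrDr wedgeDr.
rewrite !rmorphZ_rat [a * (_ * _)]mulrCA [b * (_ * _)]mulrCA.
exact: (wedge_scale q (b * iota x : R^o) (a * iota y : R^o)).
Qed.

Section Criterion.
Variables (L : seq (K * K)) (S : translation_surface R).
Hypothesis altL : forall l (V : zmodType) (h : K -> K -> V), balanced h ->
  (forall a, h a a = 0) -> teval (fun a b => h (l * a) b) L *+ 2 = 0.
Hypothesis detL : forall p : K -> rat,
  (forall q a b, p (q *: a + b) = q * p a + p b) ->
  teval (fun a b => p a *: b) L = 0 -> p 1 = 0.
Hypothesis SAF_L : forall v, SAF S v =
  teval (fun a b => wedge (- v 0 1 / norm2 v * iota a : R^o)
                          (v 0 0 / norm2 v * iota b : R^o)) L *+ 8.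

Lemma number_direction_SAF v : number_direction iota v -> SAF S v = 0.
Proof.
case/number_directionP=> c [a [b vE]]; rewrite SAF_L.
have [a0|a0] := eqVneq a 0.
  rewrite /teval big1 ?mul0rn // => x _.
  by rewrite vE !mxE /= a0 rmorph0 mulr0 !mul0r wedge0r.
have h := altL (- (b / a)) (balanced_wedge (v 0 0 / norm2 v) (v 0 0 / norm2 v))
  (fun x => wedgevv _).
(* [altL] kills twice the sum, so 8 is split as 2 * 4. *)
rewrite -[8%N]/(2 * 4)%N mulrnA -[RHS](mul0rn _ 4); congr (_ *+ _).
rewrite -[RHS]h; congr (_ *+ _); apply: eq_bigr => x _ /=; congr wedge.
rewrite rmorphM rmorphN fmorph_div; move: (norm2 v)^-1 => N.
by rewrite vE !mxE /=; field; rewrite fmorph_eq0.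
Qed.

Lemma SAF_number_direction v : v != 0 -> SAF S v = 0 -> number_direction iota v.
Proof.
move=> nv; rewrite SAF_L; have N0 : norm2 v != 0 by rewrite norm2_eq0.
have [v0|v0] := eqVneq (v 0 0) 0.
  by move=> _; exists 0, 1; rewrite oner_eq0 orbT v0 rmorph0 mul0r mulr0.
set a := v 0 0 / norm2 v; have a0 : a != 0 by rewrite mulf_neq0 ?invr_eq0.
pose l := v 0 1 / v 0 0.
have -> : - v 0 1 / norm2 v = - l * a by rewrite /l /a; field; rewrite N0.
move=> S0; apply: contrapT => nd.
have Ul : ~ range iota l.
  case=> m _ ml; apply: nd; exists 1, m; rewrite oner_eq0 ml rmorph1 /l.
  by split=> //; field.
have U0 : range iota 0 by exists 0; rewrite ?rmorph0.
have Ucl : rat_closed (range iota).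
  move=> q _ _ [x _ <-] [y _ <-]; exists (q *: x + y) => //.
  by rewrite rmorphD rmorphZ_rat.
have [p [plin pU pl]] := rational_functional U0 Ucl Ul.
have p0 : p 0 = 0 by apply: pU.
have pD x y : p (x + y) = p x + p y.
  by have := plin 1 x y; rewrite rmorph1 !mul1r.
have pZ q x : p (ratr q * x) = q * p x.
  by have := plin q x 0; rewrite p0 !addr0.
have pZa q x : p (ratr q * x / a) = q * p (x / a) by rewrite -mulrA pZ.
(* Dividing by [a] removes the common scale of both arguments. As [p] vanishes on K, of each term
   only [p (l * iota x.1)] times [iota x.2] survives, up to the scale, and [detL] applies to x ->
   p(l x). *)
pose w (x y : R^o) : R := ratr (p (x / a)) * y - ratr (p (y / a)) * x.
have wDl (u u' t : R^o) : w (u + u') t = w u t + w u' t.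
  by rewrite /w mulrDl pD rmorphD; ring.
have wDr (u t t' : R^o) : w u (t + t') = w u t + w u t'.
  by rewrite /w mulrDl pD rmorphD; ring.
have wZl (c : rat) (u t : R^o) : w (ratr c *: u) t = ratr c * w u t.
  by rewrite /w /GRing.scale /= pZa rmorphM; ring.
have wZr (c : rat) (u t : R^o) : w u (ratr c *: t) = ratr c * w u t.
  by rewrite /w /GRing.scale /= pZa rmorphM; ring.
have wvv (u : R^o) : w u u = 0 by rewrite /w subrr.
have := wedge_form_sum wDl wDr wZl wZr wvv L
  (fun x => - l * a * iota x.1 : R^o) (fun x => a * iota x.2 : R^o) 8.
move: S0; rewrite /teval => ->.
have -> : wedge_form w 0 = 0.
  have := wedge_form_sum wDl wDr wZl wZr wvv [::]
    (fun x : K => 0 : R^o) (fun=> 0 : R^o) 1.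
  by rewrite !big_nil mulr1n.
move/esym/eqP; rewrite mulrn_eq0 /= => /eqP S0.
have p1 : p (l * iota 1) = 0.
  apply: (detL (p := fun x => p (l * iota x))).
    by move=> q x y; rewrite rmorphD rmorphZ_rat mulrDr pD mulrCA pZ.
  apply: (fmorph_inj iota); rewrite rmorph0 /teval rmorph_sum.
  apply: (mulfI a0); rewrite mulr0 -[RHS]oppr0 -[in RHS]S0 -sumrN mulr_sumr.
  apply: eq_bigr => x _; rewrite rmorphZ_rat /w.
  rewrite (_ : - l * a * _ / a = ratr (-1) * (l * iota x.1)); last first.
    by rewrite rmorphN rmorph1; field.
  rewrite (_ : a * _ / a = iota x.2); last by field.
  by rewrite pZ (pU (iota x.2)) ?rmorph0; [rewrite mulN1r rmorphN; ring | exists x.2].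
by move: p1; rewrite rmorph1 mulr1 pl.
Qed.

Lemma alg_periodic_number_direction v :
  alg_periodic S v <-> v != 0 /\ number_direction iota v.
Proof.
split=> -[v0 h].
  exact: conj v0 (SAF_number_direction v0 h).
exact: conj v0 (number_direction_SAF h).
Qed.

Lemma periodic_direction_field : is_periodic_direction_field S (range iota).
Proof.
have dir (a b : K) : (a != 0) || (b != 0) -> alg_periodic S (vec2 (iota a) (iota b)).
  move=> ab; apply/alg_periodic_number_direction; split; last first.
    by exists a, b; split=> //; rewrite !mxE /= mulrC.
  apply: contraL ab => /eqP/rowP h; have := h 0; have := h 1; rewrite !mxE /=.
  by rewrite -negb_and negbK => /eqP + /eqP; rewrite !fmorph_eq0 => -> ->.
split.
  exists (vec2 (iota 1) (iota 0)), (vec2 (iota 1) (iota 1)), (vec2 (iota 0) (iota 1)).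
  split; first by split; apply: dir; rewrite oner_eq0 ?orbT.
  by split; rewrite /det2 !mxE /= rmorph0 rmorph1 ?(mul0r, mulr0, mul1r, subr0, sub0r);
    rewrite ?oppr_eq0 oner_eq0.
move=> g gU [/alg_periodic_transform h1 /alg_periodic_transform h2
  /alg_periodic_transform h3].
(* In the original coordinates slope [l] is the direction of r + l s, where normalization makes r, s
   and r + s periodic, hence defined over K. *)
have decomp l : vec2 1 l *m invmx g =
    vec2 1 0 *m invmx g + l *: (vec2 0 1 *m invmx g).
  rewrite scalemxAl -mulmxDl; congr (_ *m _).
  by apply: vec2P; rewrite !mxE /=; ring.
have dM : det2 (vec2 1 0 *m invmx g) (vec2 0 1 *m invmx g) != 0.
  rewrite det2_mul mulf_neq0 //; last by rewrite -unitfE -unitmxE unitmx_inv.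
  by rewrite /det2 !mxE /= mulr1 mulr0 subr0 oner_eq0.
move: h2; rewrite decomp scale1r => h2.
have slopes := number_direction_slopes dM (proj2 (proj1 (alg_periodic_number_direction _) h1))
  (proj2 (proj1 (alg_periodic_number_direction _) h3))
  (proj2 (proj1 (alg_periodic_number_direction _) h2)).
have nv l : vec2 1 l != 0 :> 'rV[R]_2.
  by apply/eqP => /rowP/(_ 0); rewrite !mxE /= => /eqP; rewrite oner_eq0.
have nvg l : vec2 1 l *m invmx g != 0.
  by apply: contra (nv l) => /eqP h; rewrite -(mulmxKV gU (vec2 1 l)) h mul0mx.
apply/seteqP; split=> l.
  move/(proj1 (alg_periodic_transform _ _ _))/(proj1 (alg_periodic_number_direction _)).
  by rewrite decomp => -[_ /(proj1 (slopes l))].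
move/(proj2 (slopes l)); rewrite -decomp => h.
apply/(proj2 (alg_periodic_transform _ _ _))/(proj2 (alg_periodic_number_direction _)).
by split; [exact: nvg|].
Qed.

End Criterion.

Lemma range_sum I (r : seq I) (F : I -> R) :
  (forall i, range iota (F i)) -> range iota (\sum_(i <- r) F i).
Proof.
move=> h; elim/big_ind: _ => [|_ _ [a _ <-] [b _ <-]|//].
  by exists 0; rewrite ?rmorph0.
by exists (a + b); rewrite ?rmorphD.
Qed.

(** Unfolding only changes signs of coordinates, and chains have rational weights. *)
Lemma holonomy_range (P : right_angled_table R) :
  (forall c k i, range iota (@corner R P c k 0 i)) ->
  forall v, holonomy (unfolding P) v -> forall i, range iota (v 0 i).
Proof.
move=> hP v [c _ ->] i; rewrite summxE; apply: range_sum => e; rewrite mxE.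
have rN x : range iota x -> range iota (- x).
  by case=> a _ <-; exists (- a); rewrite ?rmorphN.
suff [a _ <-] : range iota (side e.1 e.2 0 i).
  by exists (c e *: a); rewrite ?rmorphZ_rat.
rewrite /= /unfold_side mxE; set s := reflect2 _ _.
have rZ (b : bool) x : range iota x -> range iota ((-1) ^+ b * x).
  by case: b => h; rewrite ?expr0 ?expr1 ?mul1r // mulN1r; exact: rN.
apply: (rZ); rewrite /s mxE.
have rE t k j : range iota (edge (@corner R P) t k 0 j).
  by rewrite !mxE; have [a _ <-] := hP t (k + 1) j; have [b _ <-] := hP t k j;
    exists (a - b); rewrite ?rmorphB.
by case: ifP => _; apply: rZ.
Qed.

End PeriodicDirections.

(* MathComp-Analysis; a number field K contained in the reals is given as a
   finite extension K of rat with an embedding iota, and identified with its image. *)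
Theorem theorem1p7 (R : realType) (K : fieldExtType rat) (iota : {rmorphism K -> R}) :
  exists P : right_angled_table R,
    completely_algebraically_periodic (unfolding P) /\
    is_periodic_direction_field (unfolding P) (range iota).
Proof.
have [L [areaL altL detL]] := symmetric_tensor iota.
have [Q LQ posQ] := positive_tensor areaL.
have [n [w [h [w_gt0 h_gt0 QE]]]] := staircase_tensor posQ.
have LE := teq_trans LQ QE.
have n_gt0 : (0 < n)%N.
  rewrite lt0n; apply/eqP => n0; move: areaL.
  by rewrite (teq_area iota LE) n0 /area /staircase /= big_nil ltxx.
pose P := number_field_table n_gt0 w_gt0 h_gt0.
(* The wedge of the scaled embeddings is balanced, so the value computed on the staircase carries
   back to [L], for which [altL] and [detL] hold. *)
have SAF_L v : SAF (unfolding P) v =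
    teval (fun a b => wedge (- v 0 1 / norm2 v * iota a : R^o)
                            (v 0 0 / norm2 v * iota b : R^o)) L *+ 8.
  rewrite SAF_staircase; congr (_ *+ _); apply/esym/LE.
  exact: balanced_wedge.
exists P; split; last exact: (periodic_direction_field altL detL SAF_L).
move=> v hv v0; apply/(alg_periodic_number_direction altL detL SAF_L); split=> //.
have hol : forall i, range iota (v 0 i).
  apply: (holonomy_range (P := P)) hv => c k i.
  rewrite /= /stair_corner /grid mxE.
  by case: ifP => _;
    [exists (\sum_(i < (node c k).1) w i)|exists (\sum_(i < (node c k).2) h i)].
have [a _ va] := hol 0; have [b _ vb] := hol 1.
exists a, b; split; last by rewrite -va -vb mulrC.
rewrite -negb_and; apply: contra v0 => /andP[/eqP a0 /eqP b0].
by apply/eqP/vec2P; rewrite mxE -?va -?vb ?a0 ?b0 rmorph0.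
Qed.
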